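(* Let $k<n$ and let $C=(c_{ij})$ be a $k\times n$ matrix with real entries. For $i=1,\dots,k$ let $F_i=c_{i1}\odot x_1\oplus\cdots\oplus c_{in}\odot x_n$, and for each $(n-k+1)$-subset $J$ of $\{1,\dots,n\}$ let $G_J$ be the corresponding circuit of $C$. Then the intersection $$\bigcap_{J\subset\{1,\dots,n\},\ |J|=n-k+1}\mathcal{T}(G_J)\ \subset\ \mathbb{TP}^{n-1}$$ is a tropical linear space of codimension $k$ in $\mathbb{TP}^{n-1}$. It is always contained in the prevariety $$\mathcal{T}(F_1)\cap\mathcal{T}(F_2)\cap\cdots\cap\mathcal{T}(F_k)\ \subset\ \mathbb{TP}^{n-1}.$$ The two intersections are equal if and only if none of the $k\times k$ submatrices $C_I$ of $C$ is tropically singular.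
   Context: Tropical arithmetic: $x\oplus y=\min\{x,y\}$, $x\odot y=x+y$. $\mathbb{TP}^{n-1}=\mathbb{R}^n/\mathbb{R}(1,\dots,1)$. For a tropical linear form $L=\bigoplus_{j\in S} b_j\odot x_j$ indexed by a subset $S\subseteq\{1,\dots,n\}$, the tropical hyperplane $\mathcal{T}(L)\subset\mathbb{TP}^{n-1}$ is the set of points $x$ at which $\min_{j\in S}(b_j+x_j)$ is attained at least twice. A tropical prevariety is a finite intersection of tropical hypersurfaces (in particular, of tropical hyperplanes). For a $k\times k$ matrix $A=(a_{ij})$ the tropical determinant is $\det_{\mathrm{trop}}(A)=\min_{\sigma\in S_k}(a_{1,\sigma_1}+\cdots+a_{k,\sigma_k})$, and $A$ is tropically singular if this minimum is attained more than once, i.e. by at least two permutations. For a $k$-subset $I$ of $\{1,\dots,n\}$, $C_I$ is the $k\times k$ submatrix of $C$ with column indices $I$, and $w_I=\det_{\mathrm{trop}}(C_I)$. For an $(n-k+1)$-subset $J=\{j_0,j_1,\dots,j_{n-k}\}$ with complement $J^c$, the circuit $G_J$ of $C$ is the tropical linear form $$G_J=w_{J^c\cup\{j_0\}}\odot x_{j_0}\ \oplus\ w_{J^c\cup\{j_1\}}\odot x_{j_1}\ \oplus\cdots\oplus\ w_{J^c\cup\{j_{n-k}\}}\odot x_{j_{n-k}}.$$ Let $K=\overline{\mathbb{C}(t)}$ be the algebraic closure of the field of rational functions; each nonzero $p\in K$ has a Puiseux series $c_1t^{q_1}+c_2t^{q_2}+\cdots$ with $c_i\ne0$ and $q_1<q_2<\cdots$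 rational, and $\mathrm{order}(p)=q_1$. For a homogeneous ideal $I\subset K[x_1^{\pm1},\dots,x_n^{\pm1}]$ with variety $V(I)\subset(K\setminus\{0\})^n$, $\mathcal{T}(I)$ is the image in $\mathbb{TP}^{n-1}$ of the topological closure in $\mathbb{R}^n$ of $\{(\mathrm{order}(p_1),\dots,\mathrm{order}(p_n)) : (p_1,\dots,p_n)\in V(I)\}$. A tropical linear space is a subset of $\mathbb{TP}^{n-1}$ of the form $\mathcal{T}(I)$ where $I$ is generated by linear forms $p_1(t)x_1+\cdots+p_n(t)x_n$ with $p_i(t)\in K$. Codimension $k$ in $\mathbb{TP}^{n-1}$ means dimension $n-1-k$.
   Formalization: ''Tropical linear space'' over K is claimed only for C with rational entries, and for all real C over the field of generalized power series with real exponents, since orders in K are rational and the claim fails over K for C=(0,√2). *)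

(* Defs.v *)
From HB Require Import structures.
From mathcomp Require Import all_boot all_order all_algebra all_fingroup.
From mathcomp Require Import generic_quotient.
From mathcomp Require Import all_classical all_reals all_analysis.
From mathcomp Require Import complex.

Set Implicit Arguments.
Unset Strict Implicit.
Unset Printing Implicit Defensive.

Import Order.TTheory GRing.Theory Num.Theory.
Import numFieldNormedType.Exports.

Local Open Scope classical_set_scope.
Local Open Scope ring_scope.
Local Open Scope quotient_scope.

(* TP^(n-1) = R^n / R(1, ..., 1) *)

Section TropicalProjectiveSpace.
Variables (R : realType) (n : nat).

Definition tp_rel (x y : 'rV[R]_n) : bool :=
  `[< exists l : R, x = y + const_mx l >].

Lemma tp_rel_refl : reflexive tp_rel.
Proof. by move=> x; apply/asboolP; exists 0; rewrite addr0. Qed.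

Lemma tp_rel_sym : symmetric tp_rel.
Proof.
suff H x y : tp_rel x y -> tp_rel y x by move=> x y; apply/idP/idP; apply: H.
move=> /asboolP[l ->]; apply/asboolP; exists (- l).
by apply/rowP => j; rewrite !mxE addrK.
Qed.

Lemma tp_rel_trans : transitive tp_rel.
Proof.
move=> y x z /asboolP[l ->] /asboolP[m ->]; apply/asboolP; exists (m + l).
by apply/rowP => j; rewrite !mxE addrA.
Qed.

Definition tp_equiv := EquivRel tp_rel tp_rel_refl tp_rel_sym tp_rel_trans.

Definition TP : Type := {eq_quot tp_equiv}.

Definition to_TP (x : 'rV[R]_n) : TP := \pi_({eq_quot tp_equiv}) x.

End TropicalProjectiveSpace.

Section TropicalMatrices.
Variable R : realType.

Definition perm_weight k (A : 'M[R]_k) (s : 'S_k) : R := \sum_i A i (s i).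

(* The default value of the iterated minimum is one of its terms, so this is
   the plain minimum over 'S_k. *)
Definition trop_det k (A : 'M[R]_k) : R :=
  \big[Num.min/perm_weight A 1%g]_(s : 'S_k) perm_weight A s.

Definition trop_singular k (A : 'M[R]_k) : Prop :=
  exists s1 s2 : 'S_k, [/\ s1 != s2,
    perm_weight A s1 = trop_det A & perm_weight A s2 = trop_det A].

(* The j-th column of C_I is the column of C indexed by the j-th smallest
   element of I. Meaningful when #|I| = k; otherwise C_I is truncated or padded
   with zero columns so as to remain a k x k matrix. *)
Definition col_submx k n (C : 'M[R]_(k, n)) (I : {set 'I_n}) : 'M[R]_k :=
  \matrix_(i, j) [seq C i l | l <- enum I]`_j.

Definition plucker k n (C : 'M[R]_(k, n)) (I : {set 'I_n}) : R :=
  trop_det (col_submx C I).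

(* The hyperplane of the form with coefficients b j, j in S: two distinct
   indices of S realize the minimum. The values of b outside S are ignored. *)
Definition trop_hyperplane n (S : {set 'I_n}) (b : 'I_n -> R) : set (TP R n) :=
  @to_TP R n @` [set x : 'rV[R]_n | exists i j : 'I_n,
    [/\ i \in S, j \in S, i != j,
        forall l, l \in S -> b i + x 0 i <= b l + x 0 l &
        forall l, l \in S -> b j + x 0 j <= b l + x 0 l]].

Definition row_hyperplane k n (C : 'M[R]_(k, n)) (i : 'I_k) : set (TP R n) :=
  trop_hyperplane [set: 'I_n]%SET (fun j => C i j).

Definition circuit_hyperplane k n (C : 'M[R]_(k, n)) (J : {set 'I_n}) :
    set (TP R n) :=
  trop_hyperplane J (fun j => plucker C (j |: ~: J)%SET).

End TropicalMatrices.

Section Dimension.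
Variable R : realType.

Definition polyhedron n (P : set 'rV[R]_n) : Prop :=
  exists m (A : 'M[R]_(m, n)) (b : 'cV[R]_m),
    P = [set x : 'rV[R]_n | forall i, (A *m x^T) i 0 <= b i 0].

(* P contains d + 1 affinely independent points, i.e. the dimension of its
   affine hull is at least d. *)
Definition aff_dim_ge n (P : set 'rV[R]_n) (d : nat) : Prop :=
  exists (x0 : 'rV[R]_n) (V : 'M[R]_(d, n)),
    [/\ P x0, forall i, P (x0 + row i V) & row_free V].

(* A finite union of polyhedra has the dimension of its largest cell. *)
Definition polyhedral_dim n (X : set 'rV[R]_n) (d : nat) : Prop :=
  exists N (P : 'I_N -> set 'rV[R]_n),
    [/\ forall i, polyhedron (P i),
        X = \bigcup_(i in [set: 'I_N]) P i,
        forall i, ~ aff_dim_ge (P i) d.+1 &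
        exists i, aff_dim_ge (P i) d].

(* The preimage in R^n of a subset of TP^(n-1) contains the line R(1, ..., 1)
   in its lineality space, hence the shift by one. *)
Definition TP_dim n (X : set (TP R n)) (d : nat) : Prop :=
  polyhedral_dim (@to_TP R n @^-1` X) d.+1.

Definition TP_codim n (X : set (TP R n)) (k : nat) : Prop :=
  TP_dim X (n.-1 - k)%N.

End Dimension.

(* Formal series sum_q f(q) t^q with complex coefficients and real exponents,
   represented by their coefficient functions. *)

Section Series.
Variable R : realType.

Definition gseries : Type := R -> R[i].

Definition ser_monomial (c : R[i]) (q : R) : gseries :=
  fun r => if r == q then c else 0.

Definition ser_supp (f : gseries) : set R := [set q | f q != 0].

Definition well_ordered_supp (f : gseries) : Prop :=
  forall B : set R, B `<=` ser_supp f -> B !=set0 ->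
  exists2 m, B m & forall q, B q -> m <= q.

(* f is a Laurent series in t^(1/N) for some N > 0. *)
Definition puiseux_supp (f : gseries) : Prop :=
  exists (N : nat) (b : int), (0 < N)%N /\
    forall q, ser_supp f q -> exists2 z : int, b <= z & q = z%:~R / N%:R.

(* The sum of the product rule runs over a finite set as soon as the supports
   are well ordered. *)
Definition series_expansion (K : fieldType) (e : K -> gseries) : Prop :=
  [/\ e 1 = ser_monomial 1 0,
      forall x y q, e (x + y) q = e x q + e y q &
      forall x y q, e (x * y) q = \sum_(r \in [set: R]) e x r * e y (q - r)].

(* K, with iota, is an algebraic closure of C(t), and e maps each element of K
   to its Puiseux series. (K algebraically closed comes from its type;
   injectivity of e is automatic.) *)
Definition puiseux_closure (K : closedFieldType)
    (iota : {rmorphism {fraction {poly R[i]}} -> K}) (e : K -> gseries) : Prop :=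
  [/\ forall x : K, algebraicOver iota x,
      series_expansion e,
      forall c : R[i], e (iota (tofrac c%:P)) = ser_monomial c 0,
      e (iota (tofrac 'X)) = ser_monomial 1 1 &
      forall x, puiseux_supp (e x)].

(* e identifies K with C((t^R)), the field of all generalized power series with
   real exponents. Orders of elements of the closure of C(t) are rational, so
   over that field {x | x_0 = c + x_1} is a tropical linear space only for
   rational c; linear spaces with arbitrary real data need real exponents. *)
Definition generalized_series_field (K : fieldType) (e : K -> gseries) : Prop :=
  series_expansion e /\
  forall f : gseries, well_ordered_supp f <-> exists x, e x = f.

Definition is_order (K : fieldType) (e : K -> gseries) (p : K) (q : R) : Prop :=
  e p q != 0 /\ forall r, r < q -> e p r = 0.

End Series.

(* Laurent polynomials in n variables, as coefficient functions on the exponent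
   vectors; only finitely supported functions are used. *)

Section Laurent.
Variables (K : fieldType) (n : nat).

Definition laurent : Type := 'rV[int]_n -> K.

Definition laurent_eval (f : laurent) (p : 'I_n -> K) : K :=
  \sum_(m \in [set: 'rV[int]_n]) f m * \prod_i p i ^ (m 0 i).

Definition linear_form (a : 'I_n -> K) : laurent :=
  fun m => \sum_i (if m == delta_mx 0 i then a i else 0).

(* Terms c x^d span the Laurent polynomial ring additively, so it is enough to
   ask for stability under multiplication by terms. *)
Definition laurent_ideal (I : set laurent) : Prop :=
  [/\ I (fun=> 0),
      forall f g, I f -> I g -> I (fun m => f m + g m) &
      forall (c : K) (d : 'rV[int]_n) f, I f -> I (fun m => c * f (m - d))].

Definition ideal_gen (S : set laurent) : set laurent :=
  \bigcap_(I in [set I | laurent_ideal I /\ S `<=` I]) I.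

Definition torus_variety (I : set laurent) : set ('I_n -> K) :=
  [set p | (forall i, p i != 0) /\ forall f, I f -> laurent_eval f p = 0].

End Laurent.

Section TropicalVarieties.
Variables (R : realType) (K : fieldType) (e : K -> gseries R) (n : nat).

Definition trop_variety (I : set (laurent K n)) : set (TP R n) :=
  @to_TP R n @` closure [set v : 'rV[R]_n | exists2 p, torus_variety I p &
    forall i, is_order e (p i) (v 0 i)].

Definition tropical_linear_space (X : set (TP R n)) : Prop :=
  exists m (a : 'M[K]_(m, n)),
    X = trop_variety (ideal_gen [set linear_form (a i) | i in [set: 'I_m]]).

End TropicalVarieties.

(* Main.v *)
(* Write w_I for the tropical Plucker coordinates; optimal matchings of the rows
   with the columns of I are exchanged throughout.

   If a point x lies on all circuits, choose I minimizing w_I + sum_(l in I) x_l: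
   a unique minimum of row r at a column a would put a in every minimizer I,
   while the circuit through I - a provides a minimizer avoiding a.  Conversely,
   for x on all row hyperplanes, rerouting an optimal matching along second
   minima of the rows shows that a circuit has a second minimum, unless a
   maximal submatrix is singular; and a singular C_I yields, by Cramer's rule, a
   point on the row hyperplanes but off the circuits.

   The intersection of the circuits is tropically linear because it is the
   tropicalization of the kernel of a generic lift M of C, whose maximal minors
   have order exactly w_I: points of the kernel satisfy the circuits by column
   expansion of minors, and a point x on the circuits is lifted to a generic
   combination of the fundamental circuits of a set I minimizing
   w_I + sum_(l in I) x_l.

   For the dimension, a cell spanned by n - k + 1 directions would have
   n - k + 1 independent coordinates, two of which the circuit on these
   coordinates identifies; the cell around the Cramer solution x_j = w_(U - j)
   for some |U| = k + 1, with large coordinates outside U, has dimension n - k. *)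

Require Import Defs.
From HB Require Import structures.
From mathcomp Require Import all_boot all_order all_algebra all_fingroup.
From mathcomp Require Import all_classical all_reals all_analysis.
From mathcomp Require Import finmap generic_quotient complex.
From mathcomp Require Import lra zify.

Set Implicit Arguments.
Unset Strict Implicit.
Unset Printing Implicit Defensive.

Import Order.TTheory GRing.Theory Num.Theory.
Import numFieldNormedType.Exports.

Local Open Scope classical_set_scope.
Local Open Scope ring_scope.

(** * Matchings and tropical Plucker coordinates *)

Section Matchings.
Variables (R : realType) (k n : nat).
Implicit Types (C : 'M[R]_(k, n)) (f g : 'I_k -> 'I_n) (I T U : {set 'I_n}).

(** Rows are matched with columns by plain functions rather than by permutations of [col_submx], so
    that an optimal choice can be rerouted from one column set to another. *)
Definition matching f I : Prop :=
  injective f /\ (f @: [set: 'I_k] = I)%SET.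

Definition weight C f : R := \sum_i C i (f i).

Lemma matching_card f I : matching f I -> #|I| = k.
Proof. by case=> inj_f <-; rewrite card_imset // cardsT card_ord. Qed.

Lemma matching_in f I i : matching f I -> f i \in I.
Proof. by case=> _ <-; rewrite imset_f ?inE. Qed.

Lemma matching_inv f I j : matching f I -> j \in I -> exists i, f i = j.
Proof. by case=> _ <- /imsetP[i _ ->]; exists i. Qed.

Lemma matching_sub f I :
  injective f -> (forall i, f i \in I) -> #|I| = k -> matching f I.
Proof.
move=> inj_f fI cI; split=> //; apply/eqP.
rewrite eqEcard cI card_imset // cardsT card_ord leqnn andbT.
by apply/fintype.subsetP => _ /imsetP[i _ ->].
Qed.

Lemma matching_sum f I (x : 'I_n -> R) :
  matching f I -> \sum_i x (f i) = \sum_(l in I) x l.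
Proof.
case=> inj_f <-; rewrite big_imset /=; last by move=> i j _ _ /inj_f.
by apply: eq_bigl => i; rewrite inE.
Qed.

Lemma trop_det_le m (A : 'M[R]_m) (s : 'S_m) : trop_det A <= perm_weight A s.
Proof. exact: bigmin_le. Qed.

Lemma trop_det_attained m (A : 'M[R]_m) :
  exists s : 'S_m, perm_weight A s = trop_det A.
Proof.
rewrite /trop_det; elim/big_rec: _ => [|s x _ [s' <-]]; first by exists 1%g.
by case: leP => _; [exists s | exists s'].
Qed.

Lemma col_submx_enum C I : #|I| = k ->
  exists2 m, matching m I & forall i j, col_submx C I i j = C i (m j).
Proof.
move=> cI; exists (fun j => enum_val (cast_ord (esym cI) j)).
  apply: matching_sub => // [i j /enum_val_inj/cast_ord_inj //|i].
  exact: enum_valP.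
move=> i j; rewrite mxE.
set j' := cast_ord _ j.
have sj : (j < size (enum I))%N by rewrite -cardE cI.
by rewrite (nth_map (enum_val j')) // [in RHS](enum_val_nth (enum_val j')).
Qed.

Lemma matching_perm m f I : matching m I -> matching f I ->
  exists s : 'S_k, forall i, f i = m (s i).
Proof.
move=> mI fI.
have [s sP] : exists s : 'I_k -> 'I_k, forall i, m (s i) = f i.
  apply: (@fin_all_exists _ (fun=> 'I_k) (fun i j => m j = f i)) => i.
  exact: matching_inv mI (matching_in i fI).
have inj_s : injective s by move=> i j e; apply: fI.1; rewrite -!sP e.
by exists (perm inj_s) => i; rewrite permE sP.
Qed.

Lemma matching_comp m I (s : 'S_k) : matching m I -> matching (m \o s) I.
Proof.
move=> mI; apply: matching_sub (matching_card mI).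
  by move=> i j /mI.1/perm_inj.
by move=> i; apply: matching_in mI.
Qed.

Lemma plucker_le C f I : matching f I -> plucker C I <= weight C f.
Proof.
move=> fI; have [m mI mE] := col_submx_enum C (matching_card fI).
have [s sP] := matching_perm mI fI.
apply: le_trans (trop_det_le _ s) _; rewrite le_eqVlt; apply/orP; left.
by apply/eqP; apply: eq_bigr => i _; rewrite mE sP.
Qed.

Lemma plucker_attained C I : #|I| = k ->
  exists2 f, matching f I & weight C f = plucker C I.
Proof.
move=> cI; have [m mI mE] := col_submx_enum C cI.
have [s sP] := trop_det_attained (col_submx C I).
exists (m \o s); first exact: matching_comp.
by rewrite /plucker -sP; apply: eq_bigr => i _; rewrite mE.
Qed.

(** Minors of a lift take their columns in the arbitrary order [m]; reordering only permutes the
    weights and keeps their minimum. *)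
Lemma plucker_matching C m I :
  matching m I -> plucker C I = trop_det (\matrix_(i, j) C i (m j)).
Proof.
move=> mI.
have wE s : perm_weight (\matrix_(i, j) C i (m j)) s = weight C (m \o s).
  by apply: eq_bigr => i _; rewrite mxE.
apply: le_anti; apply/andP; split.
  have [s <-] := trop_det_attained (\matrix_(i, j) C i (m j)).
  by rewrite wE; apply: plucker_le; apply: matching_comp.
have [f fI <-] := plucker_attained C (matching_card mI).
have [s sP] := matching_perm mI fI.
have -> : f = m \o s by apply/funext => i; rewrite sP.
by rewrite -wE; apply: trop_det_le.
Qed.

Lemma trop_singularP C I : #|I| = k ->
  trop_singular (col_submx C I) <->
  exists f g, [/\ matching f I, matching g I, exists i, f i != g i,
    weight C f = plucker C I & weight C g = plucker C I].
Proof.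
move=> cI; have [m mI mE] := col_submx_enum C cI.
have wE s : perm_weight (col_submx C I) s = weight C (m \o s).
  by apply: eq_bigr => i _; rewrite mE.
split=> [[s [t [st ws wt]]]|[f [g [fI gI [i fg] wf wg]]]].
  exists (m \o s), (m \o t); split; rewrite -?wE //; try exact: matching_comp.
  have [/forallP eq_st|/forallPn[i ne]] := boolP [forall i, s i == t i].
    by case/eqP: st; apply/permP => i; apply/eqP.
  by exists i; apply: contra ne => /eqP/mI.1->.
have [s sP] := matching_perm mI fI; have [t tP] := matching_perm mI gI.
have ms : m \o s = f by apply/funext => j; rewrite sP.
have mt : m \o t = g by apply/funext => j; rewrite tP.
exists s, t; split; rewrite ?wE ?ms ?mt //.
by apply: contraNneq fg => st; rewrite sP tP st.
Qed.

End Matchings.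

(** * Circuits and rows *)

Lemma exists_argmin (R : realType) (T : finType) (P : pred T) (v : T -> R) :
  (exists t, P t) -> exists2 t, P t & forall u, P u -> v t <= v u.
Proof.
case=> t0 Pt0; have [t Pt tmin] := arg_minP v Pt0.
by exists t.
Qed.

Section MinTwice.
Variables (R : realType) (n : nat).
Implicit Types (S : {set 'I_n}) (v : 'I_n -> R).

Definition min_twice S v : Prop := exists i j : 'I_n,
  [/\ i \in S, j \in S, i != j,
      forall l, l \in S -> v i <= v l & forall l, l \in S -> v j <= v l].

Lemma eq_min_twice S v w :
  (forall l, l \in S -> v l = w l) -> min_twice S v -> min_twice S w.
Proof.
move=> vw [i [j [iS jS ij mi mj]]]; exists i, j; split=> // l lS.
  by rewrite -!vw //; apply: mi.
by rewrite -!vw //; apply: mj.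
Qed.

Lemma min_twiceI S v a : a \in S -> (forall l, l \in S -> v a <= v l) ->
  (exists b, [/\ b \in S, b != a & v b <= v a]) -> min_twice S v.
Proof.
move=> aS mina [b [bS ba vba]]; exists a, b.
by split; rewrite // 1?eq_sym // => l /mina/(le_trans vba).
Qed.

Lemma min_twice_other S v a : min_twice S v -> exists b,
  [/\ b \in S, b != a & forall l, l \in S -> v b <= v l].
Proof.
case=> i [j [iS jS ij mi mj]].
by case: (eqVneq i a) => [ia|]; [exists j; rewrite eq_sym -ia | exists i].
Qed.

End MinTwice.

Section Exchange.
Variables (R : realType) (k n : nat).
Hypothesis hkn : (k < n)%N.
Implicit Types (C : 'M[R]_(k, n)) (f g : 'I_k -> 'I_n) (I T U : {set 'I_n}).

(** Circuits are indexed by the complement [T] of [J], of size [k - 1], so that the coefficient of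
    [x j] is the Plucker coordinate of [j |: T]. *)
Definition circuits_vanish C (x : 'I_n -> R) : Prop :=
  forall T, #|T|.+1 = k ->
    min_twice (~: T)%SET (fun j => plucker C (j |: T)%SET + x j).

Definition rows_vanish C (x : 'I_n -> R) : Prop :=
  forall r, min_twice [set: 'I_n]%SET (fun j => C r j + x j).

Definition upd f r j : 'I_k -> 'I_n := fun i => if i == r then j else f i.

Lemma upd_sum f r j (F : 'I_k -> 'I_n -> R) :
  \sum_i F i (upd f r j i) + F r (f r) = \sum_i F i (f i) + F r j.
Proof.
rewrite (bigD1 r) //= [in RHS](bigD1 r) //= /upd eqxx.
rewrite (eq_bigr (fun i => F i (f i))); last by move=> i /negPf ->.
by rewrite addrAC [RHS]addrAC; congr (_ + _); apply: addrC.
Qed.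

Lemma upd_matching f I r j : matching f I -> j \notin I ->
  matching (upd f r j) (j |: I :\ f r)%SET.
Proof.
move=> fI jI; have fj i : (f i == j) = false.
  by apply/negbTE; apply: contraNneq jI => <-; apply: matching_in fI.
apply: matching_sub => [i l|i|].
- rewrite /upd; case: (eqVneq i r) => [->|ir]; case: (eqVneq l r) => [->|lr] //.
  + by move/esym/eqP; rewrite fj.
  + by move/eqP; rewrite fj.
  + exact: fI.1.
- rewrite /upd !inE; case: (eqVneq i r) => [_|ir]; first by rewrite eqxx.
  by rewrite (inj_eq fI.1) ir (matching_in _ fI) orbT.
- rewrite cardsU1 !inE (negPf jI) andbF.
  by rewrite -(matching_card fI) (cardsD1 (f r) I) (matching_in _ fI).
Qed.

Lemma ex_card_set m : (m <= n)%N -> exists I : {set 'I_n}, #|I| = m.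
Proof.
move=> le_mn; exists (widen_ord le_mn @: [set: 'I_m])%SET.
by rewrite card_imset ?cardsT ?card_ord // => i j [/val_inj].
Qed.

Lemma circuits_rows C x : circuits_vanish C x -> rows_vanish C x.
Proof.
move=> Cx r.
have [a _ mina] : exists2 a, a \in [set: 'I_n]%SET &
    forall l, l \in [set: 'I_n]%SET -> C r a + x a <= C r l + x l.
  by apply: exists_argmin; exists (Ordinal hkn); rewrite inE.
apply: (min_twiceI (a := a)) => //.
apply: contrapT => uniq.
have lt_a b : b != a -> C r a + x a < C r b + x b.
  by move=> ba; rewrite ltNge; apply/negP => le; apply: uniq; exists b.
pose phi I := plucker C I + \sum_(l in I) x l.
(* If [a] is not in [I], moving row [r] of an optimal matching to column [a] gives a set with
   strictly smaller [phi]. *)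
have a_in I : #|I| = k -> (forall I', #|I'| == k -> phi I <= phi I') -> a \in I.
  move=> cI minI; apply: contraT => aI.
  have [f fI wf] := plucker_attained C cI.
  have f'I := upd_matching r fI aI.
  have /minI := introT eqP (matching_card f'I).
  rewrite /phi -(matching_sum x fI) -(matching_sum x f'I).
  have := plucker_le C f'I.
  have := upd_sum f r a (fun i l => C i l + x l).
  rewrite !big_split /= -[\sum_i C i (f i)]/(weight C f) wf.
  have /lt_a : f r != a by apply: contraNneq aI => <-; apply: matching_in fI.
  by rewrite /weight; lra.
have [I /eqP cI minI] : exists2 I : {set 'I_n}, #|I| == k &
    forall I', #|I'| == k -> phi I <= phi I'.
  apply: exists_argmin; have [I <-] := ex_card_set (ltnW hkn).
  by exists I.
have aI := a_in I cI minI.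
have cT : #|(I :\ a)%SET|.+1 = k by rewrite -cI (cardsD1 a I) aI.
have [b [bT ba minb]] := min_twice_other a (Cx _ cT).
rewrite !inE ba /= in bT.
have cI' : #|(b |: I :\ a)%SET| = k by rewrite cardsU1 !inE (negPf bT) andbF.
have /minb : a \in (~: (I :\ a))%SET by rewrite !inE eqxx.
rewrite finset.setD1K // => le_b.
(* The circuit makes [b |: I :\ a] as good as [I], hence another minimizer, and minimizers contain
   [a]. *)
suff : a \in (b |: I :\ a)%SET by rewrite !inE eqxx orbF eq_sym (negPf ba).
apply: a_in => // I' /minI; apply: le_trans.
rewrite /phi (big_setU1 b) /=; last by rewrite !inE (negPf bT) andbF.
by rewrite (big_setD1 a aI) /= !addrA lerD2r.
Qed.

End Exchange.

Lemma exists_upper_bound (R : realType) (T : finType) (v : T -> R) :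
  exists2 H, 0 <= H & forall t, v t < H.
Proof.
exists (\sum_t `|v t| + 1) => [|t].
  by rewrite addr_ge0 ?sumr_ge0.
apply: le_lt_trans (ler_norm _) _; rewrite (bigD1 t) //=.
have : 0 <= \sum_(i | i != t) `|v i| by apply: sumr_ge0.
by lra.
Qed.

(** * From row hyperplanes to circuits, and the obstruction by singular submatrices *)

Section RowsToCircuits.
Variables (R : realType) (k n : nat).
Hypothesis hkn : (k < n)%N.
Implicit Types (C : 'M[R]_(k, n)) (f g : 'I_k -> 'I_n) (I T U : {set 'I_n}).

(* Follow, from an optimal matching s of T + j0, the rows through a second
   minimal entry phi r <> s r; rerouting s along a minimal closed set A of rows
   either stays in T + j0, which is then singular, or leaves it through a column
   j replacing j0, which is the second minimum of the circuit. *)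
Lemma rows_circuits C x :
  (forall I, #|I| = k -> ~ trop_singular (col_submx C I)) ->
  rows_vanish C x -> circuits_vanish C x.
Proof.
move=> nonsing Yx T cT.
have [j0 j0T minj0] : exists2 j, j \in (~: T)%SET & forall l, l \in (~: T)%SET ->
    plucker C (j |: T)%SET + x j <= plucker C (l |: T)%SET + x l.
  apply: exists_argmin; apply/set0Pn; rewrite -card_gt0.
  by have := cardsC T; rewrite card_ord; move: cT hkn; case: #|(~: T)%SET| => //; lia.
rewrite inE in j0T; apply: (min_twiceI (a := j0)) => //; first by rewrite inE.
have cTj j : j \notin T -> #|(j |: T)%SET| = k by move=> jT; rewrite cardsU1 jT.
set I := (j0 |: T)%SET; have cI : #|I| = k := cTj _ j0T.
have [s sI ws] := plucker_attained C cI.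
have [phi phiP] : exists phi : 'I_k -> 'I_n, forall r,
    phi r != s r /\ forall l, C r (phi r) + x (phi r) <= C r l + x l.
  apply: (@fin_all_exists _ (fun=> 'I_n) (fun r b =>
    b != s r /\ forall l, C r b + x b <= C r l + x l)) => r.
  have [b [_ bs minb]] := min_twice_other (s r) (Yx r).
  by exists b; split=> // l; apply: minb; rewrite inE.
have [r0 sr0] : exists r, s r = j0 by apply: matching_inv sI _; rewrite !inE eqxx.
(* [g] follows [phi] from row to row through the columns of [I]; a row whose second minimum leaves
   [I] is sent to [r0], the row of [j0]. *)
have [g gP] : exists g : 'I_k -> 'I_k, forall r,
    (phi r \in I -> s (g r) = phi r) /\ (phi r \notin I -> g r = r0).
  apply: (@fin_all_exists _ (fun=> 'I_k) (fun r r' =>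
    (phi r \in I -> s r' = phi r) /\ (phi r \notin I -> r' = r0))) => r.
  by case: (boolP (phi r \in I)) => [/(matching_inv sI)[r']|_];
    [exists r' | exists r0].
have [A minA] : {A | minset [pred A | (A != finset.set0) && (g @: A \subset A)%SET] A}.
  apply: ex_minset; exists [set: 'I_k]%SET => /=; rewrite finset.subsetT andbT.
  by apply/set0Pn; exists r0; rewrite inE.
have /minsetP[/andP[A0 gA] _] := minA.
(* Minimality of [A] forces [g] to permute it, so at most one row of [A] escapes from [I]. *)
have gAE : (g @: A)%SET = A.
  apply: (minsetinf minA) => //=; rewrite imsetS // andbT.
  by case/set0Pn: A0 => r rA; apply/set0Pn; exists (g r); apply: imset_f.
have injgA : {in A &, injective g} by apply/imset_injP; rewrite gAE.
have gin r : r \in A -> g r \in A by move=> rA; rewrite -gAE imset_f.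
pose f r := if r \in A then phi r else s r.
have phis r r' : r \in A -> r' \notin A -> phi r = s r' -> False.
  move=> rA r'A e.
  have /(gP r).1 : phi r \in I by rewrite e (matching_in _ sI).
  by rewrite e => /sI.1 gr; move: r'A; rewrite -gr gin.
have injf : injective f.
  move=> r r'; rewrite /f; case: ifPn => rA; case: ifPn => r'A e.
  - apply: injgA => //; case: (boolP (phi r \in I)) => phiI.
      by apply: sI.1; rewrite (gP r).1 // (gP r').1 -?e.
    by rewrite (gP r).2 // (gP r').2 -?e.
  - by case: (phis _ _ rA r'A).
  - by case: (phis _ _ r'A rA).
  - exact: sI.1.
have lef : \sum_i (C i (f i) + x (f i)) <= \sum_i (C i (s i) + x (s i)).
  apply: ler_sum => i _; rewrite /f; case: ifP => // _; exact: (phiP i).2.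
rewrite !big_split /= -/(weight C f) -/(weight C s) ws (matching_sum x sI) in lef.
(* If row [r1] escapes, column [phi r1] replaces [j0]: row [r0] lies in [A] and gives up [j0], which
   no other row takes. *)
have [/existsP[r1 /andP[r1A phir1]]|/existsPn noesc] :=
    boolP [exists r, (r \in A) && (phi r \notin I)].
  exists (phi r1); have gr1 : g r1 = r0 by rewrite (gP r1).2.
  have r0A : r0 \in A by rewrite -gr1 gin.
  have [phi1 phiT] : phi r1 != j0 /\ phi r1 \notin T.
    by split; move: phir1; rewrite !inE negb_or => /andP[].
  rewrite inE phiT phi1; split=> //.
  have fT : matching f (phi r1 |: T)%SET.
    apply: matching_sub => // [r|]; last exact: cTj.
    rewrite /f; case: ifPn => rA.
      have [->|rr1] := eqVneq r r1; first by rewrite !inE eqxx.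
      have gr : g r != r0.
        by apply: contra rr1 => /eqP gr; apply/eqP/injgA; rewrite // gr gr1.
      have phiI : phi r \in I.
        by apply: contraT => /(gP r).2 e; rewrite e eqxx in gr.
      have phij0 : phi r != j0.
        by rewrite -(gP r).1 // -sr0 (inj_eq sI.1).
      by move: phiI; rewrite !inE (negPf phij0) /= => ->; rewrite orbT.
    have : s r \in I by apply: matching_in sI.
    rewrite !inE -sr0 (inj_eq sI.1); case: (eqVneq r r0) => [e|_ /= ->].
      by rewrite e r0A in rA.
    by rewrite orbT.
  have := plucker_le C fT; move: lef.
  by rewrite (matching_sum x fT) !big_setU1 //= -/I; lra.
(* Otherwise [f] is a second matching of [I], no heavier than the optimal [s], and differs from it
   on [A]. *)
have phiI r : r \in A -> phi r \in I.
  by move=> rA; have := noesc r; rewrite rA /= negbK.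
have fI : matching f I.
  apply: matching_sub => // r; rewrite /f; case: ifPn => [/phiI //|_].
  exact: matching_in sI.
case: (nonsing I cI); apply/trop_singularP => //; exists f, s.
split=> //; last first.
  apply: le_anti; rewrite (plucker_le C fI) andbT.
  by move: lef; rewrite (matching_sum x fI) lerD2r.
by case/set0Pn: A0 => r rA; exists r; rewrite /f rA; apply: (phiP r).1.
Qed.

Lemma tperm_sum (F : 'I_k -> 'I_n -> R) f i j : i != j ->
  \sum_l F l (f (tperm j i l)) + F j (f j) + F i (f i) =
  \sum_l F l (f l) + F j (f i) + F i (f j).
Proof.
move=> ij; rewrite (bigD1 j) //= (bigD1 i) //= tpermL tpermR.
rewrite [in RHS](bigD1 j) //= [in RHS](bigD1 i) //=.
rewrite (eq_bigr (fun l => F l (f l))); first by lra.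
by move=> l /andP[lj li]; rewrite tpermD // eq_sym.
Qed.

(* When row i0 is matched differently by two optimal matchings of I, the
   tropical cofactors of row i0 (Cramer's rule), extended by a large constant
   outside I, vanish on all rows but not on the circuits through I. *)
Lemma singular_separation C I : #|I| = k -> trop_singular (col_submx C I) ->
  exists x, rows_vanish C x /\ ~ circuits_vanish C x.
Proof.
move=> cI /(trop_singularP C cI)[f1 [f2 [f1I f2I [i0 f12] w1 w2]]].
have [h hP] : exists h : 'I_n -> 'I_k -> 'I_n, forall j, j \in I ->
    [/\ matching (h j) I, h j i0 = j & forall f, matching f I -> f i0 = j ->
      weight C (h j) <= weight C f].
  apply: (@fin_all_exists _ (fun=> 'I_k -> 'I_n) (fun j f => j \in I ->
    [/\ matching f I, f i0 = j & forall f', matching f' I -> f' i0 = j ->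
      weight C f <= weight C f'])) => j.
  have [jI|_] := boolP (j \in I); last by exists f1.
  have [i f1i] := matching_inv f1I jI.
  have [f /asboolP[fI fj] minf] : exists2 f : {ffun 'I_k -> 'I_n},
      `[< matching f I /\ f i0 = j >] &
      forall f' : {ffun 'I_k -> 'I_n}, `[< matching f' I /\ f' i0 = j >] ->
        weight C f <= weight C f'.
    apply: exists_argmin; exists (finfun (f1 \o tperm i0 i)).
    apply/asboolP; split; last by rewrite ffunE /= tpermL.
    have -> : (finfun (f1 \o tperm i0 i) : _ -> _) = f1 \o tperm i0 i.
      by apply/funext => l; rewrite ffunE.
    exact: matching_comp.
  exists f => _; split=> // f' f'I f'j.
  have e : (finfun f' : _ -> _) = f' by apply/funext => l; rewrite ffunE.
  have := minf (finfun f'); rewrite e; apply; exact/asboolP.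
(* For [j] in [I], this is the tropical cofactor of row [i0] and column [j]: the least weight of
   matching the other rows with [I :\ j]. *)
pose c j := weight C (h j) - C i0 j.
(* [H1] keeps columns outside [I] from being minimal in a row, [H2] from being minimal in the
   circuit used at the end. *)
have [H1 H1_ge0 H1P] := exists_upper_bound (fun t : 'I_k * 'I_n * 'I_n =>
  C t.1.1 t.1.2 + c t.1.2 - C t.1.1 t.2).
have [H2 H2_ge0 H2P] := exists_upper_bound (fun t : 'I_n * {set 'I_n} =>
  plucker C I + c t.1 - plucker C t.2).
pose x j := if j \in I then c j else H1 + H2.
have xI j : j \in I -> x j = c j by rewrite /x => ->.
have xIC j : j \notin I -> x j = H1 + H2 by rewrite /x => /negPf ->.
have ci0 j : C i0 j + c j = weight C (h j) by rewrite /c addrC subrK.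
have row_min i j : j \in I -> (forall l, l \in I -> C i j + c j <= C i l + c l) ->
    forall l, l \in [set: 'I_n]%SET -> C i j + x j <= C i l + x l.
  move=> jI minj l _; rewrite xI //; have [lI|lI] := boolP (l \in I).
    by rewrite xI ?minj.
  by rewrite xIC //; have := H1P (i, j, l) => /=; lra.
exists x; split=> [i|Cx].
  have [->{i}|ii0] := eqVneq i i0.
    (* [C i0 l + c l] is the least weight of a matching of [I] with row [i0] at [l], hence at least
       [plucker C I], with equality at the columns chosen by [f1] and [f2]. *)
    have opt f : matching f I -> weight C f = plucker C I -> forall l, l \in I ->
        C i0 (f i0) + c (f i0) <= C i0 l + c l.
      move=> fI wf l lI; rewrite !ci0.
      have [_ _ /(_ _ fI erefl)] := hP _ (matching_in i0 fI).
      have [hlI _ _] := hP _ lI; rewrite wf => /le_trans -> //; exact: plucker_le.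
    exists (f1 i0), (f2 i0); split; rewrite ?inE //.
      by apply: row_min (opt _ f1I w1); apply: matching_in f1I.
    by apply: row_min (opt _ f2I w2); apply: matching_in f2I.
  (* In another row [i], exchanging rows [i0] and [i] in [h j] bounds the cofactor at [h j i] and
     makes that column a second minimum. *)
  have [j jI minj] : exists2 j, j \in I &
      forall l, l \in I -> C i j + c j <= C i l + c l.
    by apply: exists_argmin; exists (f1 i0); apply: matching_in f1I.
  have [hjI hji0 _] := hP _ jI.
  have h'I := matching_comp (tperm i0 i) hjI.
  have jI' := matching_in i hjI.
  have le' : C i (h j i) + c (h j i) <= C i j + c j.
    have [_ _ /(_ _ h'I)] := hP _ jI'; rewrite /= tpermL => /(_ erefl).
    have := tperm_sum (fun l => C l) (h j) ii0; rewrite hji0 /c -!/(weight C _).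
    by rewrite /weight /=; lra.
  exists j, (h j i); split; rewrite ?inE //.
  - by rewrite -{1}hji0 (inj_eq hjI.1) eq_sym.
  - exact: row_min.
  - by apply: row_min => // l /minj; apply: le_trans.
(* In the circuit with complement [I :\ a], every column other than [a] lies outside [I], so [a] is
   the only minimum. *)
have aI := matching_in i0 f1I; set a := f1 i0 in aI.
have cT : #|(I :\ a)%SET|.+1 = k by rewrite -cI (cardsD1 a I) aI.
have [b [bT ba minb]] := min_twice_other a (Cx _ cT).
rewrite !inE ba /= in bT.
have /minb : a \in (~: (I :\ a))%SET by rewrite !inE eqxx.
rewrite finset.setD1K // (xI a) // (xIC b) //.
by have := H2P (a, (b |: I :\ a)%SET) => /=; lra.
Qed.
End RowsToCircuits.

(** * Dimension *)

Section PluckerExchange.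
Variables (R : realType) (k n : nat).
Implicit Types (C : 'M[R]_(k, n)) (f g : 'I_k -> 'I_n) (I T U : {set 'I_n}).

(* Swap the optimal matchings f of T + j and g of U - j along the alternating
   path starting at j: A is the set of its rows, and its other endpoint is the
   only column of g(A) missed by f. *)
Lemma plucker_exchange C T U j : #|T|.+1 = k -> #|U| = k.+1 ->
  j \in U -> j \notin T -> exists j',
  [/\ j' \in U, j' \notin T, j' != j &
      plucker C (j' |: T)%SET + plucker C (U :\ j')%SET <=
      plucker C (j |: T)%SET + plucker C (U :\ j)%SET].
Proof.
move=> cT cU jU jT.
have cTj l : l \notin T -> #|(l |: T)%SET| = k by move=> lT; rewrite cardsU1 lT.
have cUj l : l \in U -> #|(U :\ l)%SET| = k.
  by move=> lU; move: cU; rewrite (cardsD1 l) lU => -[].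
have [f fT wf] := plucker_attained C (cTj _ jT).
have [g gU wg] := plucker_attained C (cUj _ jU).
have [r0 fr0] : exists r, f r = j by apply: matching_inv fT _; rewrite !inE eqxx.
pose Z (B : {set 'I_k}) := [set r | f r \in (g @: B)%SET]%SET.
pose h B := (r0 |: Z B)%SET.
have hS (B B' : {set 'I_k}) : B \subset B' -> h B \subset h B'.
  move=> BB'; apply: finset.setUS; apply/fintype.subsetP => r; rewrite !inE.
  by apply/fintype.subsetP/imsetS.
have [A minA] : {A | minset [pred A : {set 'I_k} | h A \subset A] A}.
  by apply: ex_minset; exists [set: 'I_k]%SET; rewrite /= finset.subsetT.
have /minsetP[/= hA _] := minA.
have hAE : h A = A by apply: (minsetinf minA) => //=; apply: hS.
have r0A : r0 \in A by rewrite -hAE !inE eqxx.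
have gU' r : (g r \in U) && (g r != j).
  by have := matching_in r gU; rewrite !inE andbC.
have r0Z : r0 \notin Z A.
  apply/negP; rewrite inE fr0 => /imsetP[r _ e].
  by have := gU' r; rewrite -e eqxx andbF.
have ZA r : r \in A -> r != r0 -> exists2 r', r' \in A & f r = g r'.
  rewrite -{1}hAE in_setU1 => /orP[->//|]; rewrite inE => /imsetP[r' r'A ->] _.
  by exists r'.
have AZ r r' : r \in A -> f r' = g r -> r' \in A.
  by move=> rA e; rewrite -hAE !inE e imset_f ?orbT.
pose E := (g @: A :\: (f @: Z A))%SET.
(* [A] is the disjoint union of [r0] and [Z A], and [f] maps [Z A] into [g @: A]; counting leaves
   exactly one column over. *)
have cE : #|E| = 1%N.
  have fZ : (f @: Z A \subset g @: A)%SET.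
    by apply/fintype.subsetP => _ /imsetP[r rZ ->]; rewrite inE in rZ.
  rewrite cardsD (finset.setIidPr fZ) !card_imset; try exact: fT.1; try exact: gU.1.
  by rewrite -{1}hAE cardsU1 r0Z addnK.
have /eqP/cards1P[j' Ej'] := cE.
have : j' \in E by rewrite Ej' inE eqxx.
rewrite inE => /andP[j'f /imsetP[r1 r1A gr1]].
have uniq r : r \in A -> g r != j' -> exists2 r', r' \in A & g r = f r'.
  move=> rA grj'.
  have : g r \notin E by rewrite Ej' inE.
  rewrite inE (imset_f _ rA) andbT negbK => /imsetP[r' r'Z ->].
  by exists r' => //; rewrite -hAE !inE; rewrite inE in r'Z; rewrite r'Z orbT.
have j'fr r : f r != j'.
  apply: contra j'f => /eqP frj'; apply/imsetP; exists r => //.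
  by rewrite inE frj' gr1 imset_f.
have /andP[j'U j'j] : (j' \in U) && (j' != j) by rewrite gr1.
have j'T : j' \notin T.
  apply/negP => j'T; have : j' \in (j |: T)%SET by rewrite !inE j'T orbT.
  by case/(matching_inv fT) => r /eqP; rewrite (negPf (j'fr r)).
exists j'; split=> //.
pose f' r := if r \in A then g r else f r.
pose g' r := if r \in A then f r else g r.
have f'T : matching f' (j' |: T)%SET.
  apply: matching_sub; last exact: cTj.
  - move=> r r'; rewrite /f'; case: ifPn => rA; case: ifPn => r'A e.
    + exact: gU.1.
    + by case/negP: r'A; apply: AZ rA _.
    + by case/negP: rA; apply: AZ r'A _.
    + exact: fT.1.
  - move=> r; rewrite /f'; case: ifPn => rA.
      have [->|/(uniq _ rA)[r' r'A gf]] := eqVneq (g r) j'; first by rewrite !inE eqxx.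
      have := matching_in r' fT; rewrite -gf !inE.
      by have /andP[_ /negPf->] := gU' r => /= ->; rewrite orbT.
    have := matching_in r fT; rewrite !inE => /orP[/eqP e|->]; last by rewrite orbT.
    by case/negP: rA; have /fT.1-> : f r = f r0 by rewrite fr0.
have g'U : matching g' (U :\ j')%SET.
  apply: matching_sub; last exact: cUj.
  - have AgA r r' : r \in A -> r' \notin A -> f r = g r' -> False.
      move=> rA r'A e; have [rr0|/(ZA _ rA)[r'' r''A]] := eqVneq r r0.
        by have := gU' r'; rewrite -e rr0 fr0 eqxx andbF.
      by rewrite e => /gU.1 e'; rewrite e' r''A in r'A.
    move=> r r'; rewrite /g'; case: ifPn => rA; case: ifPn => r'A e.
    + exact: fT.1.
    + by case: (AgA _ _ rA r'A).
    + by case: (AgA _ _ r'A rA).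
    + exact: gU.1.
  - move=> r; rewrite /g'; case: ifPn => rA; rewrite !inE.
      rewrite j'fr /=; have [->|/(ZA _ rA)[r' _ ->]] := eqVneq r r0.
        by rewrite fr0.
      by have /andP[] := gU' r'.
    have /andP[-> _] := gU' r; rewrite andbT gr1 (inj_eq gU.1).
    by apply: contraNneq rA => ->.
have : weight C f' + weight C g' = weight C f + weight C g.
  rewrite /weight -!big_split; apply: eq_bigr => r _ /=; rewrite /f' /g'.
  by case: ifP => // _; rewrite addrC.
rewrite wf wg => <-; apply: lerD; exact: plucker_le.
Qed.

(** The tropical Cramer vector [plucker C (U :\ j)] solves every circuit, since [plucker_exchange]
    gives a second minimum next to a first one. The indices [a] and [b] depend on [T] but not on
    [x], so that all these points share one cell. *)
Lemma cramer_cell C U : #|U| = k.+1 -> exists H, forall T, #|T|.+1 = k ->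
  exists a b, [/\ a \notin T, b \notin T, a != b & forall x c,
    (forall j, j \in U -> x j = plucker C (U :\ j)%SET + c) ->
    (forall j, j \notin U -> H + c <= x j) -> forall l, l \notin T ->
    plucker C (a |: T)%SET + x a <= plucker C (l |: T)%SET + x l /\
    plucker C (b |: T)%SET + x b <= plucker C (l |: T)%SET + x l].
Proof.
move=> cU.
have [H _ HP] := exists_upper_bound (fun t : 'I_n * 'I_n * {set 'I_n} =>
  plucker C (t.1.1 |: t.2)%SET + plucker C (U :\ t.1.1)%SET -
  plucker C (t.1.2 |: t.2)%SET).
exists H => T cT.
have [a aUT mina] : exists2 a, a \in (U :\: T)%SET & forall l, l \in (U :\: T)%SET ->
    plucker C (a |: T)%SET + plucker C (U :\ a)%SET <=
    plucker C (l |: T)%SET + plucker C (U :\ l)%SET.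
  apply: exists_argmin; apply/set0Pn; rewrite -card_gt0 cardsD cU subn_gt0.
  by rewrite -cT; apply: leq_trans (subset_leq_card (subsetIr _ _)) _; apply: leqnSn.
rewrite inE in aUT; case/andP: aUT => aT aU.
have [b [bU bT ba leb]] := plucker_exchange C cT cU aU aT.
exists a, b; split; rewrite 1?eq_sym // => x c xU xUC l lT.
suff lea : plucker C (a |: T)%SET + x a <= plucker C (l |: T)%SET + x l.
  by split=> //; apply: le_trans lea; rewrite !xU // !addrA lerD2r.
rewrite xU //; have [lU|/xUC] := boolP (l \in U).
  by rewrite xU // !addrA lerD2r mina // inE lT.
by have := HP (a, l, T) => /=; lra.
Qed.

End PluckerExchange.

Section TropicalPoints.
Variables (R : realType) (n : nat).
Implicit Types x y : 'rV[R]_n.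

Lemma to_TP_eq x y : to_TP x = to_TP y -> exists c, x = y + const_mx c.
Proof. by move/eqmodP => /asboolP. Qed.

Lemma to_TP_surj (p : TP R n) : exists x, to_TP x = p.
Proof. by exists (repr p); apply: reprK. Qed.

(** Adding a constant to all coordinates preserves the condition, so any representative of a point
    can be tested. *)
Lemma trop_hyperplaneP (S : {set 'I_n}) (b : 'I_n -> R) x :
  trop_hyperplane S b (to_TP x) <-> min_twice S (fun j => b j + x 0 j).
Proof.
split=> [[y [i [j [iS jS ij mi mj]]] /to_TP_eq[c xy]]|]; last first.
  by case=> i [j H]; exists x => //; exists i, j.
have yE l : y 0 l = x 0 l + c by rewrite xy !mxE.
exists i, j; split=> // l lS; move: (mi l lS) (mj l lS); rewrite !yE; lra.
Qed.

Lemma TP_set_eq (X Y : set (TP R n)) :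
  (forall x, X (to_TP x) <-> Y (to_TP x)) -> X = Y.
Proof.
by move=> XY; apply/seteqP; split=> p; have [x <-] := to_TP_surj p; apply XY.
Qed.

End TropicalPoints.

(** * Polyhedral cells of the intersection of the circuits *)

Section Dimension.
Variables (R : realType) (k n : nat).
Hypothesis hkn : (k < n)%N.
Variable C : 'M[R]_(k, n).

Lemma circuitsP (x : 'rV[R]_n) :
  (\bigcap_(J in [set J : {set 'I_n} | #|J| = (n - k + 1)%N])
     circuit_hyperplane C J) (to_TP x) <-> circuits_vanish C (x 0).
Proof.
split=> [Xx T cT|Cx J /= cJ].
  have cTc : #|(~: T)%SET| = (n - k + 1)%N.
    by have := cardsC T; rewrite card_ord; lia.
  have /trop_hyperplaneP := Xx _ cTc; apply: eq_min_twice => l _.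
  by rewrite finset.setCK.
apply/trop_hyperplaneP; have := Cx (~: J)%SET; rewrite finset.setCK; apply.
have := cardsC J; rewrite card_ord cJ; move: (~: J)%SET => J'; lia.
Qed.

Lemma rowsP (x : 'rV[R]_n) :
  (\bigcap_(i in [set: 'I_k]) row_hyperplane C i) (to_TP x) <->
  rows_vanish C (x 0).
Proof.
split=> [Yx r|Yx r _]; first by have /trop_hyperplaneP := Yx r I.
by apply/trop_hyperplaneP; apply: Yx.
Qed.

Lemma polyhedron_finite (I : finType) (a : I -> 'I_n -> R) (b : I -> R) :
  polyhedron [set x : 'rV[R]_n | forall t, \sum_j a t j * x 0 j <= b t].
Proof.
exists #|I|, (\matrix_(i, j) a (enum_val i) j), (\col_i b (enum_val i)).
have E (x : 'rV[R]_n) i : ((\matrix_(i, j) a (enum_val i) j) *m x^T) i 0 =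
    \sum_j a (enum_val i : I) j * x 0 j.
  by rewrite !mxE; apply: eq_bigr => j _; rewrite !mxE.
apply/seteqP; split=> x /= H t; first by rewrite E mxE.
by have := H (enum_rank t); rewrite E mxE enum_rankK.
Qed.

(** [phi] names two minimal terms for each circuit; its finitely many choices give the cells of the
    decomposition. *)
Definition piece (phi : {ffun {set 'I_n} -> 'I_n * 'I_n}) : set 'rV[R]_n :=
  [set x | forall T : {set 'I_n}, #|T|.+1 = k ->
    [/\ (phi T).1 \notin T, (phi T).2 \notin T, (phi T).1 != (phi T).2 &
      forall l, l \notin T ->
        plucker C ((phi T).1 |: T)%SET + x 0 (phi T).1 <=
          plucker C (l |: T)%SET + x 0 l /\
        plucker C ((phi T).2 |: T)%SET + x 0 (phi T).2 <=
          plucker C (l |: T)%SET + x 0 l]].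

Lemma circuits_piecesP (x : 'rV[R]_n) :
  circuits_vanish C (x 0) <-> exists phi, piece phi x.
Proof.
split=> [Cx|[phi px] T cT].
  pose Q (T : {set 'I_n}) (ab : 'I_n * 'I_n) := #|T|.+1 = k ->
    [/\ ab.1 \notin T, ab.2 \notin T, ab.1 != ab.2 &
      forall l, l \notin T ->
        plucker C (ab.1 |: T)%SET + x 0 ab.1 <= plucker C (l |: T)%SET + x 0 l /\
        plucker C (ab.2 |: T)%SET + x 0 ab.2 <= plucker C (l |: T)%SET + x 0 l].
  have [phi phiP] : exists phi, forall T, Q T (phi T).
    apply: (@fin_all_exists _ (fun=> ('I_n * 'I_n)%type) Q) => T.
    have [cT|ncT] := pselect (#|T|.+1 = k); last by exists (Ordinal hkn, Ordinal hkn).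
    have [a [b [aT bT ab ma mb]]] := Cx T cT.
    exists (a, b) => _; rewrite !inE in aT bT *; split=> //= l lT.
    by split; [apply: ma | apply: mb]; rewrite inE.
  by exists (finfun phi) => T cT; rewrite ffunE; apply: phiP.
have [aT bT ab mab] := px T cT.
exists (phi T).1, (phi T).2; split; rewrite ?inE // => l; rewrite inE => /mab[] //.
Qed.

Lemma piece_polyhedron phi : polyhedron (piece phi).
Proof.
pose ep (t : {set 'I_n} * bool * 'I_n) :=
  if t.1.2 then (phi t.1.1).1 else (phi t.1.1).2.
pose valid (T : {set 'I_n}) := [&& (phi T).1 \notin T, (phi T).2 \notin T &
  (phi T).1 != (phi T).2].
pose active (t : {set 'I_n} * bool * 'I_n) :=
  [&& #|t.1.1|.+1 == k, valid t.1.1 & t.2 \notin t.1.1].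
pose a t j : R := if active t then (j == ep t)%:R - (j == t.2)%:R else 0.
(* An invalid pair chosen by [phi] becomes the unsatisfiable inequality [0 <= -1]; the other
   inactive triples give [0 <= 0]. *)
pose b t : R := if active t then
    plucker C (t.2 |: t.1.1)%SET - plucker C (ep t |: t.1.1)%SET
  else if (#|t.1.1|.+1 == k) && ~~ valid t.1.1 then -1 else 0.
have sumE t (x : 'rV[R]_n) : \sum_j a t j * x 0 j =
    if active t then x 0 (ep t) - x 0 t.2 else 0.
  rewrite /a; case: ifP => _; last by rewrite big1 // => j _; rewrite mul0r.
  have d i : \sum_j (j == i)%:R * x 0 j = x 0 i.
    rewrite (bigD1 i) //= eqxx mul1r big1 ?addr0 // => j /negPf ->.
    by rewrite mul0r.
  under eq_bigr do rewrite mulrBl.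
  by rewrite sumrB !d.
suff -> : piece phi = [set x | forall t, \sum_j a t j * x 0 j <= b t].
  exact: polyhedron_finite.
apply/seteqP; split=> x /= px.
  move=> t; rewrite sumE /b /active; case: eqP => //= cT.
  have [aT bT ab mab] := px _ cT.
  rewrite /valid aT bT ab /=; case: ifP => [lT|//].
  have [] := mab _ lT; rewrite /ep; case: ifP => _ /=; lra.
move=> T cT.
have vT : valid T.
  apply: contraT => nv; have := px (T, true, Ordinal hkn).
  by rewrite sumE /b /active /= (negPf nv) cT eqxx /=; lra.
have /and3P[aT bT ab] := vT; split=> // l lT.
have := px (T, true, l); have := px (T, false, l).
by rewrite !sumE /b /active /= vT lT cT eqxx /ep /=; lra.
Qed.

Lemma piece_aff_dim phi : ~ aff_dim_ge (piece phi) (n - k).+1.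
Proof.
move=> [x0 [V [p0 pV freeV]]].
have fullV : row_full V^T by rewrite /row_full mxrank_tr.
pose h := fullrankfun fullV; have inj_h : injective h by apply: fullrankfun_inj.
pose J := (h @: [set: 'I_(n - k).+1])%SET.
have cJ : #|J| = (n - k).+1 by rewrite card_imset // cardsT card_ord.
have cT : #|(~: J)%SET|.+1 = k.
  by have := cardsC J; rewrite card_ord cJ; move: (~: J)%SET => J'; lia.
have [aJ bJ ab m0] := p0 _ cT.
move: (aJ) (bJ); rewrite !inE !negbK => /imsetP[i _ ai] /imsetP[j _ bj].
have eqx (x : 'rV[R]_n) : piece phi x ->
    plucker C ((phi (~: J)%SET).1 |: (~: J))%SET + x 0 (phi (~: J)%SET).1 =
    plucker C ((phi (~: J)%SET).2 |: (~: J))%SET + x 0 (phi (~: J)%SET).2.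
  move=> /(_ _ cT)[_ _ _ m]; apply: le_anti.
  by rewrite (m _ bJ).1 (m _ aJ).2.
have unitW : rowsub h V^T \in unitmx := fullrowsub_unit fullV.
have ij : i != j by apply: contra ab => /eqP ij; rewrite ai bj ij.
(* The tie fixes the difference of two coordinates on the cell, so two rows of the invertible
   [rowsub h V^T] agree. *)
move: unitW; rewrite unitmxE (determinant_alternate ij) ?unitr0 // => r.
have := eqx _ (pV r); have := eqx _ p0; rewrite !mxE -/h -ai -bj; lra.
Qed.

Lemma piece_aff_dim_ge : exists phi, aff_dim_ge (piece phi) (n - k).
Proof.
have [U cU] := ex_card_set hkn.
have [H HP] := cramer_cell C cU.
pose Q (T : {set 'I_n}) (ab : 'I_n * 'I_n) := #|T|.+1 = k ->
  [/\ ab.1 \notin T, ab.2 \notin T, ab.1 != ab.2 & forall x c,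
    (forall j, j \in U -> x j = plucker C (U :\ j)%SET + c) ->
    (forall j, j \notin U -> H + c <= x j) -> forall l, l \notin T ->
    plucker C (ab.1 |: T)%SET + x ab.1 <= plucker C (l |: T)%SET + x l /\
    plucker C (ab.2 |: T)%SET + x ab.2 <= plucker C (l |: T)%SET + x l].
have [phi phiP] : exists phi, forall T, Q T (phi T).
  apply: (@fin_all_exists _ (fun=> ('I_n * 'I_n)%type) Q) => T.
  have [cT|ncT] := pselect (#|T|.+1 = k); last by exists (Ordinal hkn, Ordinal hkn).
  by have [a [b ?]] := HP T cT; exists (a, b).
exists (finfun phi).
have inP (x : 'rV[R]_n) c : (forall j, j \in U -> x 0 j = plucker C (U :\ j)%SET + c) ->
    (forall j, j \notin U -> H + c <= x 0 j) -> piece (finfun phi) x.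
  move=> xU xUC T cT; rewrite ffunE; have [aT bT ab m] := phiP T cT; split=> //.
  exact: m xU xUC.
have [j0 j0U] : exists j, j \in U by apply/set0Pn; rewrite -card_gt0 cU.
pose W := (j0 |: ~: U)%SET.
have cW : #|W| = (n - k)%N.
  rewrite cardsU1 !inE j0U /=.
  have := cardsC U; rewrite card_ord cU; move: #|(~: U)%SET| => m e.
  by rewrite add1n -[X in (X - k)%N]e addSnnS addKn.
pose w (i : 'I_(n - k)) : 'I_n := enum_val (cast_ord (esym cW) i).
have inj_w : injective w by move=> i j /enum_val_inj/cast_ord_inj.
have w_surj j : j \in W -> exists i, w i = j.
  move=> jW; exists (cast_ord cW (enum_rank_in jW j)).
  by rewrite /w cast_ordK enum_rankK_in.
(* The row of [j0] is the all-ones direction, which shifts the constant [c]; each other row raises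
   one coordinate outside [U]. *)
pose V : 'M[R]_(n - k, n) :=
  \matrix_(i, j) (if w i == j0 then 1 else (j == w i)%:R).
pose x0 : 'rV[R]_n := \row_j (if j \in U then plucker C (U :\ j)%SET else H).
exists x0, V; split.
- apply: (inP _ 0) => j jU; rewrite mxE ?jU ?(negPf jU) addr0 //.
- move=> i; apply: (inP _ (if w i == j0 then 1 else 0)) => j jU;
    rewrite !mxE ?jU ?(negPf jU); case: eqVneq => // wj0; last first.
    by case: (j == w i); rewrite ?lerD2l.
  have : w i \in W by apply: enum_valP.
  rewrite !inE (negPf wj0) /= => wU.
  by case: eqVneq => // jw; rewrite -jw jU in wU.
- apply: inj_row_free => v vV0.
  have vV j : \sum_i v 0 i * V i j = 0.
    by have /rowP/(_ j) := vV0; rewrite !mxE.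
  have [i0 wi0] : exists i, w i = j0 by apply: w_surj; rewrite !inE eqxx.
  have vi0 : v 0 i0 = 0.
    have := vV j0; rewrite (bigD1 i0) //= mxE wi0 eqxx mulr1 big1 ?addr0 //.
    move=> i ii0; rewrite mxE -wi0 (inj_eq inj_w) (negPf ii0).
    by rewrite (inj_eq inj_w) eq_sym (negPf ii0) mulr0.
  apply/rowP => i; rewrite mxE; have [->//|ii0] := eqVneq i i0.
  have := vV (w i); rewrite (bigD1 i) //= mxE -{1}wi0 (inj_eq inj_w) (negPf ii0).
  rewrite eqxx mulr1 big1 ?addr0 // => l li; rewrite mxE -wi0 (inj_eq inj_w).
  have [->|_] := eqVneq l i0; first by rewrite vi0 mul0r.
  by rewrite (inj_eq inj_w) eq_sym (negPf li) mulr0.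
Qed.

Lemma circuits_codim : TP_codim
  (\bigcap_(J in [set J : {set 'I_n} | #|J| = (n - k + 1)%N])
     circuit_hyperplane C J) k.
Proof.
rewrite /TP_codim /TP_dim; have -> : (n.-1 - k).+1 = (n - k)%N by lia.
exists #|{ffun {set 'I_n} -> 'I_n * 'I_n}|, (fun i => piece (enum_val i)).
split.
- by move=> i; apply: piece_polyhedron.
- apply/seteqP; split=> x /=.
    move=> /circuitsP/circuits_piecesP[phi px]; exists (enum_rank phi) => //.
    by rewrite enum_rankK.
  by case=> i _ px; apply/circuitsP/circuits_piecesP; exists (enum_val i).
- by move=> i; apply: piece_aff_dim.
- have [phi phiP] := piece_aff_dim_ge; exists (enum_rank phi).
  by rewrite enum_rankK.
Qed.

End Dimension.

(** * Approximation by points with coordinates in a subgroup *)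

Lemma exists_gap (R : realType) (T : finType) (v : T -> R) :
  exists2 eps : R, 0 < eps & forall t, 0 < v t -> eps < v t.
Proof.
have [H H0 HP] := exists_upper_bound (fun t => (v t)^-1).
exists (H + 1)^-1 => [|t vt]; first by rewrite invr_gt0; lra.
have H1 : 0 < H + 1 by lra.
by rewrite invf_plt ?posrE //; have := HP t; lra.
Qed.

Section Perturbation.
Variables (R : realType) (k n : nat).
Variable C : 'M[R]_(k, n).
Implicit Types x y : 'I_n -> R.

Lemma plucker_group (G : R -> Prop) (I : {set 'I_n}) : G 0 ->
  (forall a b, G a -> G b -> G (a + b)) -> (forall i j, G (C i j)) ->
  #|I| = k -> G (plucker C I).
Proof.
move=> G0 GD GC cI; have [f _ <-] := plucker_attained C cI.
by apply: big_ind => // i _; apply: GC.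
Qed.

(** There are finitely many differences of terms; moving each coordinate by less than half of a
    lower bound of the positive ones keeps them positive. *)
Lemma circuits_gap x : exists2 eps : R, 0 < eps & forall y,
  (forall j, `|x j - y j| < eps) -> forall T l i,
  plucker C (l |: T)%SET + x l < plucker C (i |: T)%SET + x i ->
  plucker C (l |: T)%SET + y l < plucker C (i |: T)%SET + y i.
Proof.
have [eps eps0 epsP] := exists_gap (fun t : 'I_n * 'I_n * {set 'I_n} =>
  (plucker C (t.1.2 |: t.2)%SET + x t.1.2) -
  (plucker C (t.1.1 |: t.2)%SET + x t.1.1)).
exists (eps / 2) => [|y xy T l i lt_li]; first by lra.
have := epsP (l, i, T); rewrite subr_gt0 => /(_ lt_li) /=.
have := xy l; have := xy i; rewrite !ltr_norml => /andP[? ?] /andP[? ?]; lra.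
Qed.

(** If a term minimal at a nearby point [y] were beaten at [x], [circuits_gap] would carry the
    strict inequality over to [y]. This handles the closure in [trop_variety]. *)
Lemma circuits_closed (S : set 'rV[R]_n) (x : 'rV[R]_n) :
  (forall y : 'rV[R]_n, S y -> circuits_vanish C (y 0)) -> closure S x ->
  circuits_vanish C (x 0).
Proof.
move=> SC clSx; have [eps eps0 gap] := circuits_gap (x 0).
have [y [Sy xy]] := clSx _ (nbhsx_ballx x _ eps0).
have {}gap := gap (y 0) (fun j => xy.2 0 j).
move=> T cT; have [a [b [aT bT ab ma mb]]] := SC y Sy T cT.
exists a, b; split=> // l lT; rewrite leNgt; apply/negP => /gap.
  by rewrite ltNge ma.
by rewrite ltNge mb.
Qed.

(* Moving the coordinates of each class of x modulo the group G by the same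
   small amount preserves both the ties, which lie in G, and the strict
   inequalities among the terms of the circuits. *)
Lemma circuits_dense (G : R -> Prop) x (eps : R) :
  (forall a b, G a -> G b -> G (a - b)) ->
  (forall z d : R, 0 < d -> exists2 q, G q & `|z - q| < d) ->
  (forall i j, G (C i j)) -> circuits_vanish C x -> 0 < eps ->
  exists y, [/\ forall j, G (y j), forall j, `|x j - y j| < eps &
    circuits_vanish C y].
Proof.
move=> GB Gdense GC Cx eps0; have [eps' eps'0 gap] := circuits_gap x.
have G0 : G 0.
  by have [q Gq _] := Gdense 0 1 ltr01; rewrite -(subrr q); apply: GB.
have GN a : G a -> G (- a) by move=> /(GB _ _ G0); rewrite sub0r.
have GD a b : G a -> G b -> G (a + b) by move=> Ga /GN/(GB _ _ Ga); rewrite opprK.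
have Gpl (I : {set 'I_n}) : #|I| = k -> G (plucker C I) by apply: plucker_group.
pose d := Num.min eps eps'.
have d0 : 0 < d by rewrite lt_min eps0.
have [rho rhoP] : exists rho : 'I_n -> R, forall j, G (rho j) /\ `|x j - rho j| < d.
  apply: (@fin_all_exists _ (fun=> R) (fun j q => G q /\ `|x j - q| < d)) => j.
  by have [q Gq xq] := Gdense (x j) d d0; exists q.
(* [pick] depends only on the predicate, so indices in one class modulo [G] get the same
   representative; the default never arises, as [j] itself qualifies. *)
pose rep j := odflt j [pick l | `[< G (x l - x j) >]].
have repP j : G (x (rep j) - x j).
  rewrite /rep; case: pickP => [l /asboolP //|/(_ j) /asboolPn[]].
  by rewrite subrr.
have eq_rep i j : G (x i - x j) -> rep i = rep j.
  move=> Gij; rewrite /rep.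
  have -> : [pick l | `[< G (x l - x i) >]] = [pick l | `[< G (x l - x j) >]].
    apply: eq_pick => l /=; apply: asbool_equiv_eq; split=> Gl.
      by have := GD _ _ Gl Gij; rewrite addrA subrK.
    by have := GB _ _ Gl Gij; rewrite opprB addrA subrK.
  by case: pickP => //= /(_ j) /asboolPn[]; rewrite subrr.
pose y j := rho (rep j) + (x j - x (rep j)).
have xy j : `|x j - y j| < d.
  have [_] := rhoP (rep j); congr (`|_| < _); rewrite /y; lra.
exists y; split=> [j|j|T cT].
- by apply: GD; [exact: (rhoP _).1 | rewrite -opprB; apply: GN].
- by have := xy j; rewrite lt_min => /andP[].
have {}/gap gap : forall j, `|x j - y j| < eps'.
  by move=> j; have := xy j; rewrite lt_min => /andP[].
have mono i l : i \notin T -> l \notin T ->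
    plucker C (i |: T)%SET + x i <= plucker C (l |: T)%SET + x l ->
    plucker C (i |: T)%SET + y i <= plucker C (l |: T)%SET + y l.
  move=> iT lT; rewrite le_eqVlt => /orP[/eqP e|/gap/ltW //].
  (* A tie puts [x i - x l] in [G], being a difference of Plucker coordinates; hence [i] and [l]
     move by the same amount. *)
  have eq : rep i = rep l.
    apply: eq_rep.
    have -> : x i - x l = plucker C (l |: T)%SET - plucker C (i |: T)%SET by lra.
    by apply: GB; apply: Gpl; rewrite cardsU1 ?iT ?lT.
  by rewrite /y eq; lra.
have [a [b [aT bT ab ma mb]]] := Cx T cT.
exists a, b; rewrite !inE in aT bT *; split=> // l lT; rewrite inE in lT.
  by apply: mono => //; apply: ma; rewrite inE.
by apply: mono => //; apply: mb; rewrite inE.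
Qed.

End Perturbation.

(** * Realization as a tropical linear space *)

Section TorusVariety.
Variables (K : fieldType) (n : nat).
Implicit Types (f g : laurent K n) (p : 'I_n -> K).

Local Notation monomial p m := (\prod_i p i ^ (m 0 i)).

Lemma laurent_evalE f p (A : {fset 'rV[int]_n}) :
  (forall m, m \notin A -> f m = 0) ->
  laurent_eval f p = \sum_(m <- A) f m * monomial p m.
Proof.
by move=> fA; apply: fsbigTE => m /fA ->; rewrite mul0r.
Qed.

Lemma laurent_eval_linear a p :
  laurent_eval (linear_form a) p = \sum_i a i * p i.
Proof.
pose A : {fset 'rV[int]_n} := [fset delta_mx 0 i | i in 'I_n]%fset.
have dA i : delta_mx 0 i \in A by apply/imfsetP; exists i.
rewrite (@laurent_evalE _ _ A) => [|m mA]; last first.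
  rewrite /linear_form big1 // => i _; case: eqP => // mi.
  by case/negP: mA; rewrite mi.
rewrite /linear_form; under eq_bigr do rewrite mulr_suml.
rewrite exchange_big; apply: eq_bigr => i _ /=.
rewrite (bigD1_seq _ (dA i)); last exact: fset_uniq.
rewrite /= eqxx [X in _ + X]big1 ?addr0; last by move=> m mi; rewrite (negPf mi) mul0r.
congr (_ * _); rewrite (bigD1 i) //= mxE !eqxx expr1z big1 ?mulr1 // => j ji.
by rewrite mxE (negPf ji) andbF expr0z.
Qed.

(** Finite support is built in so that [laurent_eval] is additive on this set. *)
Definition vanishing p : set (laurent K n) :=
  [set f | (exists A : {fset 'rV[int]_n}, forall m, m \notin A -> f m = 0) /\
    laurent_eval f p = 0].

Lemma vanishing_ideal p : (forall i, p i != 0) -> laurent_ideal (vanishing p).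
Proof.
move=> p0; split.
- split; first by exists fset0.
  by apply: fsbig1 => m _; rewrite mul0r.
- move=> f g [[A fA] f0] [[B gB] g0].
  have fAB m : m \notin (A `|` B)%fset -> f m = 0.
    by rewrite inE negb_or => /andP[/fA].
  have gAB m : m \notin (A `|` B)%fset -> g m = 0.
    by rewrite inE negb_or => /andP[_ /gB].
  split; first by exists (A `|` B)%fset => m mAB; rewrite fAB ?gAB ?addr0.
  rewrite (@laurent_evalE _ _ (A `|` B)%fset) => [|m mAB]; last first.
    by rewrite fAB ?gAB ?addr0.
  under eq_bigr do rewrite mulrDl.
  by rewrite big_split /= -!laurent_evalE // f0 g0 addr0.
- move=> c d f [[A fA] f0]; split.
    exists [fset (m + d : 'rV[int]_n)%R | m : 'rV[int]_n in A]%fset => m mA; rewrite fA ?mulr0 //.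
    apply: contra mA => mdA; apply/imfsetP; exists (m - d) => //=.
    by rewrite subrK.
  rewrite /laurent_eval (reindex_fsbigT (fun m => m + d)); last first.
    by exists (fun m => m - d) => m; rewrite ?addrK ?subrK.
  under eq_fsbigr => m _.
    rewrite addrK.
    have -> : monomial p (m + d) = monomial p d * monomial p m.
      rewrite -big_split; apply: eq_bigr => i _ /=; rewrite mxE addrC expfzDr //.
    rewrite mulrACA.
    over.
  by rewrite -mulr_fsumr -/(laurent_eval f p) f0 mulr0.
Qed.

(** When [p] solves the linear equations, [vanishing p] is an ideal containing the generators, hence
    all of [ideal_gen]. *)
Lemma torus_variety_linear m (a : 'M[K]_(m, n)) p :
  torus_variety (ideal_gen [set linear_form (a i) | i in [set: 'I_m]]) p <->
  (forall j, p j != 0) /\ forall i, \sum_j a i j * p j = 0.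
Proof.
split=> [[p0 Ip]|[p0 ap]]; split=> //.
  move=> i; rewrite -laurent_eval_linear; apply: Ip => J [_]; apply.
  by exists i.
move=> f; move/(_ (vanishing p)) => []//; split; first exact: vanishing_ideal.
move=> _ [i _ <-]; split; last by rewrite laurent_eval_linear ap.
exists [fset delta_mx 0 j | j in 'I_n]%fset => d dA.
rewrite /linear_form big1 // => j _; case: eqP => // dj; case/negP: dA.
by apply/imfsetP; exists j.
Qed.

End TorusVariety.

(** * Generic choices by avoiding the roots of polynomials *)

Section Genericity.
Variable F : numFieldType.

Lemma poly_nonroot (P : {poly F}) : P != 0 -> exists2 z, z != 0 & P.[z] != 0.
Proof.
move=> P0; apply: contrapT => noz.
(* The candidates [1, ..., size P] are one too many to be all roots. *)
pose rs : seq F := [seq i.+1%:R | i <- iota 0 (size P)].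
have rootP : all (root P) rs.
  apply/allP => _ /mapP[i _ ->]; apply/rootP; apply: contrapT => /eqP Pz.
  by apply: noz; exists i.+1%:R; rewrite // pnatr_eq0.
have uniq_rs : uniq rs.
  rewrite map_inj_uniq ?iota_uniq // => i j /eqP.
  by rewrite eqr_nat eqSS => /eqP.
by have := max_poly_roots P0 rootP uniq_rs; rewrite size_map size_iota ltnn.
Qed.

Lemma digits_inj k n (d d' : 'I_k -> 'I_n) :
  (\sum_i d i * n ^ i = \sum_i d' i * n ^ i)%N -> d =1 d'.
Proof.
elim: k d d' => [|k IH] d d' eq_dd' i; first by case: i.
have split_sum (c : 'I_k.+1 -> 'I_n) : (\sum_i c i * n ^ i =
    c ord0 + (\sum_i c (lift ord0 i) * n ^ i) * n)%N.
  rewrite big_ord_recl expn0 muln1 big_distrl /=; congr addn.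
  by apply: eq_bigr => j _; rewrite expnSr mulnA.
move: eq_dd'; rewrite !split_sum => e.
have n0 : (0 < n)%N by apply: leq_ltn_trans (ltn_ord (d ord0)).
have e0 : d ord0 = d' ord0.
  have := congr1 (modn ^~ n) e; rewrite ![(_ + _ * n)%N]addnC !modnMDl.
  by rewrite !modn_small // => /val_inj.
have e1 : (fun j => d (lift ord0 j)) =1 (fun j => d' (lift ord0 j)).
  apply: IH; apply/eqP; rewrite -(eqn_pmul2r n0).
  by move/eqP: e; rewrite e0 eqn_add2l.
by case: (unliftP ord0 i) => [j|] -> //; apply: e1.
Qed.

(* With entries z ^ (j * n ^ i), distinct permutations contribute distinct
   powers of z, so that the restricted determinants are nonzero polynomials. *)
Lemma generic_matrix k n (S : ('I_k -> 'I_n) -> pred 'S_k) :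
  (forall m, exists s, S m s) -> exists a : 'M[F]_(k, n),
  forall m, injective m ->
    \sum_(s : 'S_k | S m s) (-1) ^+ s * \prod_i a i (m (s i)) != 0.
Proof.
move=> S0.
pose E (m : 'I_k -> 'I_n) (s : 'S_k) := (\sum_i m (s i) * n ^ i)%N.
pose P (m : 'I_k -> 'I_n) : {poly F} := \sum_(s | S m s) (-1) ^+ s *: 'X^(E m s).
have Einj m s t : injective m -> E m s = E m t -> s = t.
  by move=> inj_m /digits_inj e; apply/permP => i; apply: inj_m; apply: e.
have P0 m : injective m -> P m != 0.
  move=> inj_m; have [s0 Ss0] := S0 m.
  apply/eqP => /(congr1 (fun p : {poly F} => p`_(E m s0))).
  rewrite coef0 coef_sum (bigD1 s0) //= coefZ coefXn eqxx mulr1 big1 ?addr0.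
    by move/eqP; rewrite signr_eq0.
  move=> s /andP[_ ss0]; rewrite coefZ coefXn; case: eqP => [/Einj e|]; last first.
    by rewrite mulr0.
  by rewrite e ?eqxx // in ss0.
(* A nonroot of the product serves all column choices at once. *)
pose Q := \prod_(m : {ffun 'I_k -> 'I_n} | injectiveb m) P m.
have Q0 : Q != 0 by apply/prodf_neq0 => m /injectiveP; apply: P0.
have [z _ Qz] := poly_nonroot Q0.
exists (\matrix_(i, j) z ^+ (j * n ^ i)) => m inj_m.
have : (P m).[z] != 0.
  move: Qz; rewrite horner_prod => /prodf_neq0/(_ (finfun m)).
  have e : (finfun m : 'I_k -> 'I_n) = m by apply/funext => i; rewrite ffunE.
  by rewrite e; apply; apply/injectiveP.
rewrite horner_sum; congr (_ != 0); apply: eq_bigr => s _.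
rewrite hornerZ hornerXn -prodrXr; congr (_ * _).
by apply: eq_bigr => i _; rewrite mxE.
Qed.

(** The sums are values at [z] of nonzero polynomials with coefficients [d r j]. Besides their
    roots, [z] avoids [0], so that the powers [z ^+ j] can serve as leading coefficients in the
    lift. *)
Lemma generic_combination k n (S : 'I_k -> pred 'I_n) (d : 'I_k -> 'I_n -> F) :
  (forall r, exists2 j, S r j & d r j != 0) -> exists2 z : F, z != 0 &
  forall r, \sum_(j | S r j) d r j * z ^+ j != 0.
Proof.
move=> S0; pose P r : {poly F} := \sum_(j | S r j) d r j *: 'X^j.
have P0 r : P r != 0.
  have [j0 Sj0 dj0] := S0 r.
  apply/eqP => /(congr1 (fun p : {poly F} => p`_j0)).
  rewrite coef0 coef_sum (bigD1 j0) //= coefZ coefXn eqxx mulr1 big1 ?addr0.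
    by move/eqP; rewrite (negPf dj0).
  move=> j /andP[_ jj0]; rewrite coefZ coefXn eq_sym.
  by rewrite [_ == _](negPf jj0) mulr0.
have Q0 : \prod_r P r != 0 by apply/prodf_neq0.
have [z z0 Qz] := poly_nonroot Q0; exists z => // r.
move: Qz; rewrite horner_prod => /prodf_neq0/(_ r isT).
rewrite horner_sum; congr (_ != 0); apply: eq_bigr => j _.
by rewrite hornerZ hornerXn.
Qed.

End Genericity.

(** * Calculus of leading terms of series *)

Section LeadingTerms.
Variables (R : realType) (K : fieldType) (e : K -> gseries R).
Hypothesis exp_e : series_expansion e.
Implicit Types (x y : K) (q r : R) (c d : R[i]).

(* c may be 0, when x has order greater than q. *)
Definition leads x q c : Prop := (forall r, r < q -> e x r = 0) /\ e x q = c.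

Lemma leads0 q : leads 0 q 0.
Proof.
have [_ eD _] := exp_e.
have e0 r : e 0 r = 0.
  by apply: (addrI (e 0 r)); rewrite -eD !addr0.
by split.
Qed.

Lemma leadsD x y q c d : leads x q c -> leads y q d -> leads (x + y) q (c + d).
Proof.
have [_ eD _] := exp_e.
by move=> [x0 <-] [y0 <-]; split=> [r rq|]; rewrite eD // x0 // y0 // addr0.
Qed.

Lemma leadsN x q c : leads x q c -> leads (- x) q (- c).
Proof.
have [_ eD _] := exp_e; move=> [x0 xq].
have eN r : e (- x) r = - e x r.
  apply: (addrI (e x r)); rewrite -eD !subrr.
  by have [_ ->] := leads0 r.
by split=> [r rq|]; rewrite eN ?xq // x0 // oppr0.
Qed.

Lemma leads_sum (I : Type) (s : seq I) (P : pred I) (f : I -> K) q (c : I -> R[i]) :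
  (forall i, P i -> leads (f i) q (c i)) ->
  leads (\sum_(i <- s | P i) f i) q (\sum_(i <- s | P i) c i).
Proof.
move=> fc; elim/big_ind2: _ => //; first exact: leads0.
by move=> x1 x2 y1 y2; apply: leadsD.
Qed.

Lemma leads1 : leads 1 0 1.
Proof.
have [e1 _ _] := exp_e.
by split=> [r r0|]; rewrite e1 /ser_monomial ?eqxx // lt_eqF.
Qed.

Lemma leadsM x y q r c d : leads x q c -> leads y r d -> leads (x * y) (q + r) (c * d).
Proof.
have [_ _ eM] := exp_e; move=> [x0 xq] [y0 yr].
split=> [s sqr|].
  rewrite eM; apply: fsbig1 => t _.
  have [tq|tq] := ltP t q; first by rewrite x0 ?mul0r.
  by rewrite y0 ?mulr0 //; lra.
rewrite eM (fsbigTE [fset q]%fset) => [|t]; last first.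
  rewrite inE => tq; case: (ltgtP t q) => [t_q|t_q|t_q].
  - by rewrite x0 ?mul0r.
  - by rewrite y0 ?mulr0 //; lra.
  - by rewrite t_q eqxx in tq.
by rewrite big_seq_fset1 addrC addKr xq yr.
Qed.

Lemma leads_sign (b : bool) x q c :
  leads x q c -> leads ((-1) ^+ b * x) q ((-1) ^+ b * c).
Proof. by case: b => xc; rewrite ?expr1 ?expr0 ?mulN1r ?mul1r //; apply: leadsN. Qed.

Lemma leads_prod (I : Type) (s : seq I) (f : I -> K) (q : I -> R) (c : I -> R[i]) :
  (forall i, leads (f i) (q i) (c i)) ->
  leads (\prod_(i <- s) f i) (\sum_(i <- s) q i) (\prod_(i <- s) c i).
Proof.
move=> fc; elim: s => [|i s IH]; first by rewrite !big_nil; apply: leads1.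
by rewrite !big_cons; apply: leadsM.
Qed.

Lemma leads_lt x q r c : leads x q c -> r < q -> leads x r 0.
Proof. by move=> [x0 _] rq; split=> [s sr|]; apply: x0 => //; apply: lt_trans rq. Qed.

(** Reading every summand at the smallest exponent allows terms of different orders to be added;
    only those of exactly this order contribute. *)
Lemma leads_le x q r c : leads x q c -> r <= q -> leads x r (if r == q then c else 0).
Proof.
move=> xc; case: eqVneq => [->//|rq le_rq]; apply: leads_lt xc _.
by rewrite lt_neqAle rq.
Qed.

Lemma is_orderP x q : is_order e x q <-> exists2 c, c != 0 & leads x q c.
Proof.
split=> [[xq x0]|[c c0 [x0 xq]]]; first by exists (e x q).
by split; rewrite ?xq.
Qed.

(** Only optimal permutations reach the exponent [trop_det Q]. Their signed sum may cancel, which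
    the choice of [a] in [generic_matrix] rules out. *)
Lemma leads_det k (A : 'M[K]_k) (Q : 'M[R]_k) (a : 'M[R[i]]_k) :
  (forall i j, leads (A i j) (Q i j) (a i j)) ->
  leads (\det A) (trop_det Q)
    (\sum_(s : 'S_k | perm_weight Q s == trop_det Q)
       (-1) ^+ s * \prod_i a i (s i)).
Proof.
move=> Aa; rewrite big_mkcond /=; apply: leads_sum => s _.
have : leads ((-1) ^+ s * \prod_i A i (s i)) (perm_weight Q s)
    ((-1) ^+ s * \prod_i a i (s i)).
  by apply: leads_sign; apply: leads_prod.
by rewrite eq_sym => /leads_le; apply; apply: trop_det_le.
Qed.

End LeadingTerms.

(** * Maximal minors and kernel vectors *)

Section MaximalMinors.
Variables (K : fieldType) (k n : nat) (M : 'M[K]_(k, n)).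
Implicit Types m : 'I_k -> 'I_n.

Definition minor m : K := \det (\matrix_(i, j) M i (m j)).

(** In the expansion along column [r], the cofactors do not involve that column, hence not [j]. *)
Lemma minor_upd m r j : minor (upd m r j) =
  \sum_i M i j * cofactor (\matrix_(i, j) M i (m j)) i r.
Proof.
rewrite /minor (expand_det_col _ r); apply: eq_bigr => i _.
rewrite mxE /upd eqxx; congr (_ * _); rewrite /cofactor; congr (_ * \det _).
by apply/matrixP => a b; rewrite !mxE eq_sym (negPf (neq_lift _ _)).
Qed.

Lemma minor_repeat m r s : r != s -> m r = m s -> minor m = 0.
Proof.
move=> rs e; rewrite /minor -det_tr; apply: (determinant_alternate rs) => i.
by rewrite !mxE e.
Qed.

(** By [minor_upd], the coefficients form a linear combination of the rows of [M], weighted by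
    cofactors. *)
Lemma kernel_circuit m r (p : 'I_n -> K) :
  (forall i, \sum_j M i j * p j = 0) -> \sum_j minor (upd m r j) * p j = 0.
Proof.
move=> Mp; under eq_bigr do rewrite minor_upd mulr_suml.
rewrite exchange_big big1 //= => i _.
rewrite (eq_bigr (fun j => cofactor (\matrix_(i, j) M i (m j)) i r * (M i j * p j))).
  by rewrite -mulr_sumr Mp mulr0.
by move=> j _; rewrite mulrAC mulrC.
Qed.

(** Entrywise form of the identity between [A *m \adj A] and the scalar matrix of [\det A], applied
    to column [j] of [M]. *)
Lemma cramer_rows m i j :
  \sum_r M i (m r) * minor (upd m r j) = minor m * M i j.
Proof.
set A := \matrix_(i, j) M i (m j).
under eq_bigr do rewrite minor_upd mulr_sumr.
rewrite exchange_big /= (eq_bigr (fun i' => M i' j * (A *m \adj A) i i')).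
  rewrite mul_mx_adj (bigD1 i) //= mxE eqxx mulr1n big1 ?addr0 1?mulrC //.
  by move=> i' ii'; rewrite mxE eq_sym (negPf ii') mulr0.
move=> i' _; rewrite mxE mulr_sumr; apply: eq_bigr => r _.
by rewrite !mxE mulrCA.
Qed.

(* The combination with coefficients b of the fundamental circuits of the
   columns outside the image of m. *)
Definition cramer_kernel m (b : 'I_n -> K) (l : 'I_n) : K :=
  \sum_(j | j \notin codom m) b j *
    (minor m * (l == j)%:R - \sum_r (m r == l)%:R * minor (upd m r j)).

Lemma cramer_kernelP m b i : \sum_l M i l * cramer_kernel m b l = 0.
Proof.
under eq_bigr do rewrite mulr_sumr.
rewrite exchange_big big1 //= => j _.
rewrite (eq_bigr (fun l => b j * (minor m * M i l * (l == j)%:R -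
    \sum_r M i l * (m r == l)%:R * minor (upd m r j)))); last first.
  move=> l _; rewrite mulrCA mulrBr; congr (_ * (_ - _)).
    by rewrite mulrCA mulrA.
  by rewrite mulr_sumr; apply: eq_bigr => r _; rewrite mulrA.
rewrite -mulr_sumr sumrB exchange_big /=.
rewrite (bigD1 j) //= eqxx mulr1 big1 ?addr0; last first.
  by move=> l /negPf ->; rewrite mulr0.
rewrite -cramer_rows [X in _ * (_ - X)](eq_bigr (fun r => M i (m r) * minor (upd m r j))).
  by rewrite subrr mulr0.
move=> r _; rewrite (bigD1 (m r)) //= eqxx mulr1 big1 ?addr0 // => l lr.
by rewrite eq_sym (negPf lr) mulr0 mul0r.
Qed.

Lemma cramer_kernel_notin m b l :
  l \notin codom m -> cramer_kernel m b l = b l * minor m.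
Proof.
move=> lm; rewrite /cramer_kernel (bigD1 l) //= eqxx mulr1.
rewrite [X in _ - X]big1 => [|r _]; last first.
  by case: eqP lm => [<-|_ _]; rewrite ?codom_f ?mul0r.
rewrite subr0 big1 ?addr0 // => j /andP[jm jl].
rewrite eq_sym (negPf jl) mulr0 big1 ?subr0 ?mulr0 // => r _.
by case: eqP lm => [<-|_ _]; rewrite ?codom_f ?mul0r.
Qed.

Lemma cramer_kernel_in m b r : injective m ->
  cramer_kernel m b (m r) = - \sum_(j | j \notin codom m) b j * minor (upd m r j).
Proof.
move=> inj_m; rewrite -sumrN; apply: eq_bigr => j jm.
have /negPf -> : m r != j by apply: contraNneq jm => <-; apply: codom_f.
rewrite mulr0 sub0r mulrN; congr (- (_ * _)).
rewrite (bigD1 r) //= eqxx mul1r big1 ?addr0 // => s sr.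
by rewrite (inj_eq inj_m) (negPf sr) mul0r.
Qed.

End MaximalMinors.

(** * Tropicalization of the kernel of a generic lift *)

Section Lifting.
Variables (R : realType) (k n : nat).
Hypothesis hkn : (k < n)%N.
Variable C : 'M[R]_(k, n).
Variables (K : fieldType) (e : K -> gseries R).
Hypothesis exp_e : series_expansion e.
Variable M : 'M[K]_(k, n).
Hypothesis genericM : forall m I, matching m I ->
  exists2 c, c != 0 & leads e (minor M m) (plucker C I) c.

Lemma upd_matchingD (m : 'I_k -> 'I_n) I r j : matching m I ->
  j \notin (I :\ m r)%SET -> matching (upd m r j) (j |: I :\ m r)%SET.
Proof.
move=> mI; have [jI|jI _] := boolP (j \in I); last exact: upd_matching.
rewrite !inE jI andbT negbK => /eqP ->.
rewrite finset.setD1K ?(matching_in _ mI) //.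
have -> // : upd m r (m r) = m.
by apply/funext => i; rewrite /upd; case: eqP => // ->.
Qed.

(** If a circuit had a single minimal term, the leading term of the corresponding summand in
    [kernel_circuit] could not cancel. *)
Lemma kernel_circuits_vanish (p : 'I_n -> K) (v : 'I_n -> R) :
  (forall i, \sum_j M i j * p j = 0) -> (forall j, is_order e (p j) (v j)) ->
  circuits_vanish C v.
Proof.
move=> Mp pv T cT.
have [a aT mina] : exists2 a, a \in (~: T)%SET & forall l, l \in (~: T)%SET ->
    plucker C (a |: T)%SET + v a <= plucker C (l |: T)%SET + v l.
  apply: exists_argmin; apply/set0Pn; rewrite -card_gt0.
  by have := cardsC T; rewrite card_ord; move: cT hkn; case: #|(~: T)%SET| => //; lia.
apply: (min_twiceI (a := a)) => //; apply: contrapT => uniq.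
have lt_a l : l \notin T -> l != a ->
    plucker C (a |: T)%SET + v a < plucker C (l |: T)%SET + v l.
  move=> lT la; rewrite ltNge; apply/negP => le; apply: uniq.
  by exists l; rewrite inE.
rewrite inE in aT.
have caT : #|(a |: T)%SET| = k by rewrite cardsU1 aT.
have [m mI _] := plucker_attained C caT.
have [r mr] : exists r, m r = a by apply: matching_inv mI _; rewrite !inE eqxx.
have TE : ((a |: T) :\ m r = T)%SET by rewrite mr setU1K.
have lead j : j \notin T -> exists2 c, c != 0 &
    leads e (minor M (upd m r j) * p j) (plucker C (j |: T)%SET + v j) c.
  move=> jT; have /genericM[c c0 cM] : matching (upd m r j) (j |: T)%SET.
    by rewrite -TE; apply: upd_matchingD; rewrite ?TE.
  have [d d0 dp] := (is_orderP e _ _).1 (pv j).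
  by exists (c * d); [rewrite mulf_neq0 | apply: leadsM].
have [c c0 ca] := lead a aT.
have : leads e (\sum_j minor M (upd m r j) * p j) (plucker C (a |: T)%SET + v a)
    (\sum_j if j == a then c else 0).
  (* Summands with [j] in [T] vanish because the minor repeats a column; the others besides [a] have
     larger order. *)
  apply: leads_sum => // j _; case: eqVneq => [->//|ja].
  have [jT|jT] := boolP (j \in T); last first.
    by have [d _ /leads_lt] := lead j jT; apply; apply: lt_a.
  have [s ms] : exists s, m s = j.
    by apply: matching_inv mI _; rewrite !inE jT orbT.
  have sr : s != r by apply: contra ja => /eqP sr; rewrite -ms sr mr.
  rewrite (@minor_repeat _ _ _ _ _ r s) ?mul0r; first exact: leads0.
    by rewrite eq_sym.
  by rewrite /upd eqxx (negPf sr) ms.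
rewrite kernel_circuit // -big_mkcond big_pred1_eq => -[_ c_0].
by have [_ e0] := leads0 exp_e (plucker C (a |: T)%SET + v a);
  rewrite -c_0 e0 eqxx in c0.
Qed.

Variable G : R -> Prop.
Hypothesis G0 : G 0.
Hypothesis GD : forall a b, G a -> G b -> G (a + b).
Hypothesis GN : forall a, G a -> G (- a).
Hypothesis GC : forall i j, G (C i j).
Hypothesis lift : forall q c, G q -> exists x, leads e x q c.

Lemma circuits_vanish_lift (x : 'I_n -> R) :
  circuits_vanish C x -> (forall j, G (x j)) -> exists p : 'I_n -> K,
  (forall i, \sum_j M i j * p j = 0) /\ forall j, is_order e (p j) (x j).
Proof.
move=> Cx Gx; pose phi (I : {set 'I_n}) := plucker C I + \sum_(l in I) x l.
have [I /eqP cI minI] : exists2 I : {set 'I_n}, #|I| == k &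
    forall I' : {set 'I_n}, #|I'| == k -> phi I <= phi I'.
  apply: exists_argmin; have [I <-] := ex_card_set (ltnW hkn).
  by exists I.
have [m mI _] := plucker_attained C cI.
have mcodom l : (l \in codom m) = (l \in I).
  apply/codomP/idP => [[r ->]|/(matching_inv mI)[r <-]]; first exact: matching_in mI.
  by exists r.
pose T r := (I :\ m r)%SET.
have cT r : #|T r|.+1 = k by rewrite -cI (cardsD1 (m r) I) (matching_in _ mI).
have IE r : I = (m r |: T r)%SET by rewrite finset.setD1K ?(matching_in _ mI).
have notT r j : j \notin I -> j \notin T r by apply: contra => /setD1P[].
(* This is minimality of [I] against the exchange of [m r] for [j]. *)
have ge r j : j \notin I ->
    plucker C I + x (m r) <= plucker C (j |: T r)%SET + x j.
  move=> jI; have jT := notT r j jI.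
  have /eqP/minI : #|(j |: T r)%SET| = k by rewrite cardsU1 jT.
  have mrT : m r \notin T r by rewrite !inE eqxx.
  rewrite /phi [in X in X <= _](IE r) (big_setU1 _ jT) (big_setU1 _ mrT) /=.
  by rewrite -(IE r); lra.
(* These are the columns whose fundamental circuits contribute to coordinate [m r] at the exponent
   [x (m r)]. *)
pose S r j := (j \notin I) &&
  (plucker C (j |: T r)%SET + x j == plucker C I + x (m r)).
have [d dP] : exists d : 'I_k -> 'I_n -> R[i], forall r j, j \notin I ->
    d r j != 0 /\ leads e (minor M (upd m r j)) (plucker C (j |: T r)%SET) (d r j).
  apply: (@fin_all_exists _ (fun=> 'I_n -> R[i]) (fun r d => forall j, j \notin I ->
    d j != 0 /\ leads e (minor M (upd m r j)) (plucker C (j |: T r)%SET) (d j))).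
  move=> r.
  apply: (@fin_all_exists _ (fun=> R[i]) (fun j d => j \notin I ->
    d != 0 /\ leads e (minor M (upd m r j)) (plucker C (j |: T r)%SET) d)).
  move=> j; have [jI|jI] := boolP (j \in I); first by exists 0.
  by have [c c0 cM] := genericM (upd_matchingD mI (notT r j jI)); exists c.
have [r|z z0 zP] := @generic_combination R[i] k n S d.
  (* The circuit with complement [T r] has a minimum at some [b] other than [m r]; by [ge] it ties
     with [m r], so [S r] is not empty. *)
  have [b [bT bm minb]] := min_twice_other (m r) (Cx _ (cT r)).
  rewrite inE in bT.
  have bI : b \notin I by move: bT; rewrite !inE bm.
  exists b; last by have [] := dP r b bI.
  rewrite /S bI /=; apply/eqP/le_anti; rewrite ge // andbT.
  by have := minb (m r); rewrite -IE !inE eqxx; apply.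
(* Since [minor M m] has order [plucker C I], this choice gives coordinates outside [I] the order
   [x j]. *)
have [b bP] : exists b : 'I_n -> K, forall j,
    leads e (b j) (x j - plucker C I) (z ^+ j).
  apply: (@fin_all_exists _ (fun=> K)
    (fun j y => leads e y (x j - plucker C I) (z ^+ j))) => j.
  by apply: lift; apply: GD => //; apply: GN; apply: plucker_group.
exists (cramer_kernel M m b); split=> [i|j]; first exact: cramer_kernelP.
apply/is_orderP; have [jI|jI] := boolP (j \in I); last first.
  have [c c0 cM] := genericM mI.
  exists (z ^+ j * c); first by rewrite mulf_neq0 ?expf_neq0.
  rewrite cramer_kernel_notin ?mcodom //.
  by have := leadsM exp_e (bP j) cM; rewrite subrK.
have [r <-] := matching_inv mI jI.
exists (- \sum_(j | S r j) d r j * z ^+ j); first by rewrite oppr_eq0.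
rewrite cramer_kernel_in; last exact: mI.1.
apply: leadsN => //; rewrite (eq_bigl (fun j => j \notin I)) => [|l]; last first.
  by rewrite mcodom.
rewrite big_mkcondr /=; apply: leads_sum => // l lI.
have [_ dl] := dP r l lI.
have := leads_le (leadsM exp_e (bP l) dl) (r := x (m r)).
rewrite [z ^+ l * _]mulrC.
have -> : (x (m r) == x l - plucker C I + plucker C (l |: T r)%SET) =
  (plucker C (l |: T r)%SET + x l == plucker C I + x (m r)).
  by apply/eqP/eqP; lra.
by apply; have := ge r l lI; lra.
Qed.

End Lifting.

(** [G] is a group of available exponents: the rationals for Puiseux series, all reals for
    generalized series. Points with coordinates in [G] lift exactly; density and closure supply the
    rest. *)
Lemma circuits_linear_space (R : realType) (k n : nat) (hkn : (k < n)%N)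
    (C : 'M[R]_(k, n)) (K : fieldType) (e : K -> gseries R) (G : R -> Prop) :
  series_expansion e ->
  (forall a b, G a -> G b -> G (a - b)) ->
  (forall z d : R, 0 < d -> exists2 q, G q & `|z - q| < d) ->
  (forall i j, G (C i j)) ->
  (forall q c, G q -> exists x, leads e x q c) ->
  tropical_linear_space e
    (\bigcap_(J in [set J : {set 'I_n} | #|J| = (n - k + 1)%N])
       circuit_hyperplane C J).
Proof.
move=> exp_e GB Gdense GC lift.
have G0 : G 0.
  by have [q Gq _] := Gdense 0 1 ltr01; rewrite -(subrr q); apply: GB.
have GN a : G a -> G (- a) by move=> /(GB _ _ G0); rewrite sub0r.
have GD a b : G a -> G b -> G (a + b) by move=> Ga /GN/(GB _ _ Ga); rewrite opprK.
pose Q (m : 'I_k -> 'I_n) : 'M[R]_k := \matrix_(i, j) C i (m j).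
have [a aP] := @generic_matrix R[i] k n
  (fun m s => perm_weight (Q m) s == trop_det (Q m)) (fun m =>
    let: ex_intro s sP := trop_det_attained (Q m) in ex_intro _ s (introT eqP sP)).
have [M MP] : exists M : 'I_k -> 'I_n -> K, forall i j, leads e (M i j) (C i j) (a i j).
  apply: (@fin_all_exists _ (fun=> 'I_n -> K) (fun i M => forall j,
    leads e (M j) (C i j) (a i j))) => i.
  apply: (@fin_all_exists _ (fun=> K) (fun j M => leads e M (C i j) (a i j))) => j.
  exact: lift.
have genericM m I : matching m I -> exists2 c, c != 0 &
    leads e (minor (\matrix_(i, j) M i j) m) (plucker C I) c.
  move=> mI; eexists; last first.
    rewrite (plucker_matching C mI) /minor.
    by apply: (leads_det exp_e (a := \matrix_(i, j) a i (m j))) => i j; rewrite !mxE.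
  rewrite (eq_bigr (fun s : 'S_k => (-1) ^+ s * \prod_i a i (m (s i)))).
    by apply: aP; apply: mI.1.
  by move=> s _; congr (_ * _); apply: eq_bigr => i _; rewrite mxE.
exists k, (\matrix_(i, j) M i j); apply: TP_set_eq => x; split.
  move/(circuitsP hkn) => Cx; exists x => // B /nbhs_ballP[eps /= eps0 xB].
  have [y [Gy xy Cy]] := circuits_dense GB Gdense GC Cx eps0.
  exists (\row_j y j); split; last first.
    by apply: xB; split=> // i j; rewrite ord1 mxE; apply: xy.
  have [p [Mp py]] := circuits_vanish_lift hkn exp_e genericM G0 GD GN GC lift Cy Gy.
  exists p; last by move=> i; rewrite mxE.
  apply/torus_variety_linear; split=> // j.
  have [ep _] := py j; apply: contra ep => /eqP ->.
  by have [_ ->] := leads0 exp_e (y j).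
move=> [v clv <-]; apply/(circuitsP hkn); apply: circuits_closed clv => y [p].
move=> /torus_variety_linear[_ Mp] py.
exact: (kernel_circuits_vanish (v := y 0) hkn exp_e genericM Mp py).
Qed.

(** * Orders of Puiseux series *)

Section PuiseuxOrders.
Variables (R : realType) (K : fieldType) (e : K -> gseries R).
Hypothesis exp_e : series_expansion e.
Implicit Types (x y : K) (q r : R) (c d : R[i]).

Lemma leads_order_inj x q r c d :
  c != 0 -> d != 0 -> leads e x q c -> leads e x r d -> q = r.
Proof.
move=> c0 d0 [x0 xq] [y0 xr]; case: (ltgtP q r) => // lt.
  by rewrite -xq y0 ?eqxx in c0.
by rewrite -xr x0 ?eqxx in d0.
Qed.

Lemma leadsX x q c m : leads e x q c -> leads e (x ^+ m) (q *+ m) (c ^+ m).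
Proof.
move=> xq; elim: m => [|m IH]; first exact: leads1.
by rewrite !exprS mulrS; apply: leadsM.
Qed.

Lemma leads_neq0 x q c : c != 0 -> leads e x q c -> x != 0.
Proof.
move=> c0 [_ xq]; apply: contra c0 => /eqP x0.
by rewrite -xq x0; have [_ ->] := leads0 exp_e q.
Qed.

Lemma puiseux_order_exists x : puiseux_supp (e x) -> x != 0 ->
  exists q c, c != 0 /\ leads e x q c.
Proof.
move=> [N [b [N0 supp]]] x0.
(* A zero expansion would contradict [x * x^-1 = 1]. *)
have [q0 xq0] : exists q, e x q != 0.
  apply: contrapT => ex0; have [e1 _ eM] := exp_e.
  have : e (x * x^-1) 0 = 0.
    rewrite eM; apply: fsbig1 => r _; case: (eqVneq (e x r) 0) => [->|xr].
      by rewrite mul0r.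
    by case: ex0; exists r.
  by rewrite divff // e1 /ser_monomial eqxx => /eqP; rewrite oner_eq0.
(* The support lies in this increasing sequence, so the least index with a nonzero coefficient gives
   the order. *)
pose q (t : nat) : R := (b + t%:Z)%:~R / N%:R.
have supp_q r : e x r != 0 -> exists t, r = q t.
  move=> /supp[z bz ->]; exists `|z - b|%N.
  by rewrite /q gez0_abs ?subr_ge0 // (addrC b) subrK.
have ex_t : exists t, e x (q t) != 0.
  by have [t e_t] := supp_q _ xq0; exists t; rewrite -e_t.
case: (ex_minnP ex_t) => t xt mint.
exists (q t), (e x (q t)); split=> //; split=> // r rq.
apply/eqP; apply: contraT => xr; have [s rs] := supp_q r xr.
rewrite rs in xr rq; have := mint s xr; rewrite leqNgt => /negP[].
move: rq; rewrite /q ltr_pM2r ?invr_gt0 ?ltr0n // ltr_int ltrD2l.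
by rewrite ltz_nat.
Qed.

End PuiseuxOrders.

(** The exponent [m / N] is the order of an [N]-th root of [t ^+ m], negative exponents come from
    inverses, and multiplication by a constant adjusts the coefficient. *)
Lemma puiseux_leads (R : realType) (K : closedFieldType)
    (iota : {rmorphism {fraction {poly R[i]}} -> K}) (e : K -> gseries R)
    (r : rat) (c : R[i]) :
  puiseux_closure iota e -> exists x, leads e x (ratr r) c.
Proof.
move=> [_ exp_e econst et supp].
have lconst a : leads e (iota (tofrac a%:P)) 0 a.
  split=> [s s0|]; rewrite econst /ser_monomial ?eqxx //.
  by rewrite lt_eqF.
suff [x [d [d0 xd]]] : exists x d, d != 0 /\ leads e x (ratr r) d.
  exists (iota (tofrac (c / d)%:P) * x).
  by have := leadsM exp_e (lconst (c / d)) xd; rewrite add0r divfK.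
set t := iota (tofrac 'X) in et.
have lt1 : leads e t 1 1.
  by split=> [s s1|]; rewrite et /ser_monomial ?eqxx // lt_eqF.
have root m N : (0 < N)%N -> exists y d, d != 0 /\ leads e y (m%:R / N%:R) d.
  move=> N0; have [y yN] := @solve_monicpoly K N (fun i => if i == 0%N then t ^+ m else 0) N0.
  have {}yN : y ^+ N = t ^+ m.
    case: N N0 yN => // N _ ->; rewrite big_ord_recl /= expr0 mulr1.
    by rewrite big1 ?addr0 // => i _; rewrite mul0r.
  have ltm := leadsX exp_e m lt1; rewrite -yN expr1n in ltm.
  have y0 : y != 0.
    have := leads_neq0 exp_e (oner_neq0 _) ltm.
    by apply: contraNneq => ->; rewrite expr0n eqn0Ngt N0.
  have [q [d [d0 yq]]] := puiseux_order_exists exp_e (supp y) y0.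
  have := leads_order_inj _ (oner_neq0 _) (leadsX exp_e N yq) ltm.
  rewrite expf_neq0 // => /(_ isT) qN; exists y, d; split=> //.
  have <- // : q = m%:R / N%:R.
  by rewrite -qN -[q *+ N]mulr_natr mulfK // pnatr_eq0 -lt0n.
have -> : ratr r = (numq r)%:~R / `|denq r|%N%:R :> R.
  by rewrite natr_absz gtr0_norm.
have N0 : (0 < `|denq r|)%N by rewrite absz_gt0 denq_neq0.
case: (numq r) => m; first exact: root.
have [y [d [d0 yd]]] := root m.+1 _ N0.
have y0 := leads_neq0 exp_e d0 yd.
have [q [a [a0 ya]]] := puiseux_order_exists exp_e (supp y^-1) (invr_neq0 y0).
exists y^-1, a; split=> //.
have := leads_order_inj _ (oner_neq0 _) (leadsM exp_e yd ya).
rewrite divff // mulf_neq0 // => /(_ 0 isT (leads1 exp_e)) sum0.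
have -> // : (Negz m)%:~R / `|denq r|%N%:R = q.
by rewrite NegzE mulrNz mulNr; lra.
Qed.

Lemma ratr_dense (R : realType) (z d : R) :
  0 < d -> exists2 q, (exists r : rat, q = ratr r) & `|z - q| < d.
Proof.
move=> d0; have /rat_in_itvoo[r] : z - d < z + d by lra.
rewrite in_itv /= => /andP[lo hi]; exists (ratr r); first by exists r.
by rewrite ltr_norml; apply/andP; split; lra.
Qed.

(** * The linear space, the containment and the criterion for equality *)

Theorem theorem5p3 (R : realType) (k n : nat) (hkn : (k < n)%N)
    (C : 'M[R]_(k, n)) :
  let X := \bigcap_(J in [set J : {set 'I_n} | #|J| = (n - k + 1)%N])
             circuit_hyperplane C J in
  let Y := \bigcap_(i in [set: 'I_k]) row_hyperplane C i in
  [/\ [/\ forall (K : closedFieldType)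
                (iota : {rmorphism {fraction {poly R[i]}} -> K})
                (e : K -> gseries R),
            puiseux_closure iota e ->
            (forall i j, exists q : rat, C i j = ratr q) ->
            tropical_linear_space e X,
          forall (K : fieldType) (e : K -> gseries R),
            generalized_series_field e -> tropical_linear_space e X &
          TP_codim X k],
      X `<=` Y &
      X = Y <-> forall I : {set 'I_n}, #|I| = k ->
                  ~ trop_singular (col_submx C I)].
Proof.
move=> X Y; have XY : X `<=` Y.
  move=> p; have [x <-] := to_TP_surj p => /(circuitsP hkn)/(circuits_rows hkn).
  by move/rowsP.
split=> //; first split.
- move=> K iota e Ke ratC.
  apply: (@circuits_linear_space _ _ _ _ _ _ _ (fun q => exists r : rat, q = ratr r)) => //.
  + by case: Ke.
  + by move=> _ _ [r ->] [s ->]; exists (r - s); rewrite rmorphB.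
  + exact: ratr_dense.
  + by move=> _ c [r ->]; apply: puiseux_leads Ke.
- move=> K e [exp_e all_e].
  apply: (@circuits_linear_space _ _ _ _ _ _ _ (fun=> True)) => //.
    by move=> z d d0; exists z; rewrite // subrr normr0.
  move=> q c _; have /all_e[x xE] : well_ordered_supp (ser_monomial c q).
    have mono s : ser_supp (ser_monomial c q) s -> s = q.
      by rewrite /ser_supp /ser_monomial /=; case: (eqVneq s q) => //; rewrite eqxx.
    move=> B Bsupp [s Bs]; exists s => // s' Bs'.
    by rewrite (mono _ (Bsupp _ Bs)) (mono _ (Bsupp _ Bs')).
  exists x; split=> [s sq|]; rewrite xE /ser_monomial ?eqxx // lt_eqF //.
- exact: circuits_codim.
- split=> [eqXY I cI singI|nonsing].
    have [x [Yx]] := singular_separation cI singI; apply.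
    have /(circuitsP hkn) : X (to_TP (\row_j x j)).
      rewrite eqXY; apply/rowsP => r; apply: eq_min_twice (Yx r) => l _.
      by rewrite mxE.
    by move=> Cx T cT; apply: eq_min_twice (Cx T cT) => l _; rewrite mxE.
  apply/seteqP; split=> // p; have [x <-] := to_TP_surj p.
  by move/rowsP/(rows_circuits hkn nonsing)/(circuitsP hkn).
Qed.
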